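(* For $\rho>0$ and $\alpha\in(0,\pi]$ let $D_{\rho,\alpha}=\{re^{i\vartheta}: r\in(0,\rho),\ |\vartheta|<\alpha\}$. Let $\Psi$ be analytic on $D_{s,\pi}$ for some $s>0$, and assume that as $z\to0$ in this domain, $\Psi(z)\sim -c\,z\ln z$ with $c>0$. Then for each $\alpha\in(0,\pi)$ there exist $\rho\in(0,s)$, $\rho'>0$ and a function $\Upsilon$ analytic in $D_{\rho',\alpha}$, taking its values in $D_{\rho,\pi}$, such that for all $(y,z)\in D_{\rho',\alpha}\times D_{\rho,\pi}$, $$\Psi(z)=y\iff z=\Upsilon(y).$$ Moreover, as $y\to0$ in $D_{\rho',\alpha}$, $\Upsilon(y)\sim -\dfrac{y}{c\ln y}$.
   Context: $\ln$ denotes the principal branch of the logarithm on $\mathbb{C}\setminus(-\infty,0]$: $\ln(re^{i\vartheta})=\ln r+i\vartheta$ for $r>0$, $\vartheta\in(-\pi,\pi)$. *)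

(* Defs.v *)
From Stdlib Require Import Reals Lra.
From Coquelicot Require Import Coquelicot.

Open Scope R_scope.

(* r e^{i theta}; Coquelicot has no complex exponential *)
Definition polar (r theta : R) : C := (r * cos theta, r * sin theta).

Definition sector (rho alpha : R) (z : C) : Prop :=
  exists r theta : R,
    0 < r < rho /\ Rabs theta < alpha /\ z = polar r theta.

(* Principal logarithm on the plane slit along (-oo,0]. The argument is given
   by the half-angle formula tan (theta/2) = sin theta / (1 + cos theta), so
   the value on the slit is meaningless; see [Cln_polar]. *)
Definition Cln (z : C) : C :=
  (ln (Cmod z), 2 * atan (Im z / (Cmod z + Re z))).

(* Local representability by a convergent power series at every point of [D],
   which is meant to be open. *)
Definition analytic_on (D : C -> Prop) (f : C -> C) : Prop :=
  forall z0 : C, D z0 ->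
    exists a : nat -> C,
      locally z0 (fun z : C =>
        @is_pseries C_AbsRing C_NormedModule a (Cminus z z0) (f z)).

(* f(z) ~ g(z) as z tends to 0 inside [D] *)
Definition equiv_at_0 (D : C -> Prop) (f g : C -> C) : Prop :=
  @is_equiv C C_AbsRing C_NormedModule
    (within D (locally (RtoC 0))) f g.

Lemma Cmod_polar (r theta : R) : 0 < r -> Cmod (polar r theta) = r.
Proof.
intros Hr. unfold Cmod, polar; simpl.
replace (_ + _) with (r * r * (Rsqr (sin theta) + Rsqr (cos theta)))
  by (unfold Rsqr; ring).
rewrite sin2_cos2, Rmult_1_r. apply sqrt_square. lra.
Qed.

Lemma Cln_polar (r theta : R) :
  0 < r -> - PI < theta < PI -> Cln (polar r theta) = (ln r, theta).
Proof.
intros Hr Ht. unfold Cln. rewrite (Cmod_polar r theta Hr).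
f_equal. unfold polar; simpl.
set (h := theta / 2).
assert (Hc : 0 < cos h) by (apply cos_gt_0; unfold h; lra).
replace theta with (2 * h) by (unfold h; field).
rewrite sin_2a, cos_2a_cos.
replace (r * (2 * sin h * cos h) / (r + r * (2 * cos h * cos h - 1)))
  with (tan h).
2:{ replace (r + r * (2 * cos h * cos h - 1)) with (2 * r * cos h * cos h)
      by ring.
    unfold tan; field; lra. }
rewrite atan_tan; [reflexivity | unfold h; lra].
Qed.

(* Main.v *)
Require Import Defs.
From Stdlib Require Import Reals Lra Lia ClassicalEpsilon.
From Coquelicot Require Import Coquelicot.
Open Scope R_scope.

(** Put [a y = - y / (c ln y)]. Since [ln z / ln y] tends to 1 as soon as [|z|]
is comparable to [|y| / |ln y|], the hypothesis on [Psi] says that on the disc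
[|z - a y| <= eta |a y|] (which lies in the slit plane when [|arg y| < alpha] and
[eta] is small) [Psi] differs from the linear map [z |-> (y / a y) z] by [o(|y|)].
Cauchy's estimate turns this into a small Lipschitz constant, so that [Psi] is
expanding on a smaller disc and [Psi z = y] has a solution there by contraction.
Conversely the same asymptotics force every small solution [z] to satisfy
[z / a y -> 1], whatever its argument; this gives uniqueness and the equivalent
of [Upsilon]. The derivative of [ln] is never needed.

Differentiability is used in its strict form, which a power series has at its
centre, which passes to inverse functions at once, and which makes the derivative
continuous. Cauchy's formula for strictly differentiable functions follows by
differentiating circle integrals along a homotopy. *)

(** * Strict complex differentiability *)

(** Everything is measured at the scale [|a y|]. The slope [y / a y] equals [- c ln y], the model
    with its logarithm frozen at [y], so slope times disc radius is [eta |y|] and an error [o(|y|)]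
    beats it for a fixed [eta], uniformly in [y].

    A fixed [eta] is where [alpha < PI] enters: [a y] has asymptotically the argument of [y], so the
    angle between [arg y] and the slit leaves room proportional to [|a y|].

    The ratio of the logarithms tends to 1 because their real parts differ by at most a constant
    plus [ln |ln y|], which is negligible against [|ln y|], while their imaginary parts are bounded.

    Uniqueness concerns all small [z], also those near the slit, around which no proportional disc
    fits and where the argument of [Psi z] is uncontrolled. The estimate for preimages therefore
    uses only moduli and the bound on imaginary parts; it places every solution in the one disc
    where [Psi] is known to be injective. *)

Definition strict_at (f : C -> C) (z0 d : C) : Prop :=
  forall eps : R, 0 < eps -> exists delta : R, 0 < delta /\
    forall z w : C, Cmod (z - z0) < delta -> Cmod (w - z0) < delta ->
      Cmod (f z - f w - d * (z - w)) <= eps * Cmod (z - w).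

Lemma locally_Cmod (z0 : C) (P : C -> Prop) :
  locally z0 P <->
  exists delta : R, 0 < delta /\ forall z : C, Cmod (z - z0) < delta -> P z.
Proof.
split.
- intros H. apply locally_C in H. destruct H as [d Hd].
  exists d. split; [apply cond_pos|].
  intros z Hz. apply Hd. exact Hz.
- intros [d [Hd H]]. apply locally_C. exists (mkposreal d Hd).
  intros z Hz. apply H. exact Hz.
Qed.

Lemma Cmod_sub_sym (z w : C) : Cmod (z - w) = Cmod (w - z).
Proof. rewrite <- Cmod_opp. f_equal. ring. Qed.

Lemma Cmod_sub_triangle (a z w : C) :
  Cmod (z - w) <= Cmod (z - a) + Cmod (a - w).
Proof.
replace (z - w)%C with ((z - a) + (a - w))%C by ring. apply Cmod_triangle.
Qed.

Lemma Cmod_reverse_triangle (z w : C) : Cmod z - Cmod w <= Cmod (z - w).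
Proof.
pose proof (Cmod_triangle (z - w) w) as H.
replace (z - w + w)%C with z in H by ring. lra.
Qed.

Lemma im_le_Cmod (z : C) : Rabs (Im z) <= Cmod z.
Proof.
eapply Rle_trans; [apply Rmax_r|apply Rmax_Cmod].
Qed.

Lemma Cmod_le_re_im (z : C) : Cmod z <= Rabs (Re z) + Rabs (Im z).
Proof.
replace z with (RtoC (Re z) + RtoC (Im z) * Ci)%C at 1
  by (destruct z; unfold RtoC, Ci, Cplus, Cmult; simpl; f_equal; ring).
eapply Rle_trans; [apply Cmod_triangle|].
rewrite Cmod_mult, Cmod_Ci, !Cmod_R. lra.
Qed.

Lemma Cmod_neq_0 (z : C) : 0 < Cmod z -> z <> 0%C.
Proof. intros H. apply Cmod_gt_0. exact H. Qed.

Lemma Cpow_succ (z : C) (n : nat) : (z ^ S n = z * z ^ n)%C.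
Proof. reflexivity. Qed.

(** Stated with [Cmod] so that the estimates below apply directly; the arbitrary domain lets one
    calculus serve paths on [R], homotopies on [R * R] and functions on [C]. *)
Definition cont {U : UniformSpace} (F : U -> C) (x : U) : Prop :=
  forall eps : R, 0 < eps -> locally x (fun u => Cmod (F u - F x) < eps).

Section Cont.
Context {U : UniformSpace}.
Implicit Types (F G : U -> C) (x : U).

Lemma cont_const (a : C) x : cont (fun _ : U => a) x.
Proof.
intros e He. apply filter_forall. intros _.
replace (a - a)%C with (RtoC 0) by ring. rewrite Cmod_0. exact He.
Qed.

Lemma cont_plus F G x : cont F x -> cont G x -> cont (fun u => F u + G u)%C x.
Proof.
intros HF HG e He.
generalize (filter_and (F := locally x) _ _ (HF (e/2) ltac:(lra)) (HG (e/2) ltac:(lra))).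
apply filter_imp. intros u [H1 H2].
replace (F u + G u - (F x + G x))%C with ((F u - F x) + (G u - G x))%C by ring.
eapply Rle_lt_trans; [apply Cmod_triangle|]. lra.
Qed.

Lemma cont_mult F G x : cont F x -> cont G x -> cont (fun u => F u * G u)%C x.
Proof.
intros HF HG e He.
pose proof (Cmod_ge_0 (F x)) as HFx. pose proof (Cmod_ge_0 (G x)) as HGx.
(* With both increments below [d <= 1], the product changes by less than
   [d * (d + |F x| + |G x|) <= d * K]. *)
set (K := 1 + Cmod (F x) + Cmod (G x)).
assert (HK : 1 <= K) by (unfold K; lra).
assert (HeK : 0 < e / K) by (apply Rdiv_lt_0_compat; lra).
set (d := Rmin 1 (e / K)).
assert (Hd1 : d <= 1) by apply Rmin_l.
assert (Hd2 : d * K <= e).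
{ apply Rle_trans with (e / K * K); [|right; field; lra].
  apply Rmult_le_compat_r; [lra|apply Rmin_r]. }
assert (Hd : 0 < d).
{ apply Rmin_pos; [lra|]. apply Rdiv_lt_0_compat; lra. }
generalize (filter_and (F := locally x) _ _ (HF d Hd) (HG d Hd)).
apply filter_imp. intros u [H1 H2].
replace (F u * G u - F x * G x)%C
  with ((F u - F x) * (G u - G x) + ((F u - F x) * G x + F x * (G u - G x)))%C
  by ring.
pose proof (Cmod_ge_0 (F u - F x)). pose proof (Cmod_ge_0 (G u - G x)).
eapply Rle_lt_trans; [apply Cmod_triangle|].
eapply Rle_lt_trans; [apply Rplus_le_compat_l, Cmod_triangle|].
rewrite !Cmod_mult. unfold K in Hd2. nra.
Qed.

Lemma cont_comp (f : C -> C) F x : cont f (F x) -> cont F x ->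
  cont (fun u => f (F u)) x.
Proof.
intros Hf HF e He. destruct (proj1 (locally_Cmod _ _) (Hf e He)) as [d [Hd H]].
generalize (HF d Hd). apply filter_imp. intros u Hu. now apply H.
Qed.

Lemma cont_ext_loc F G x : locally x (fun u => F u = G u) ->
  cont F x -> cont G x.
Proof.
intros HFG HF e He. pose proof (locally_singleton _ _ HFG) as Hx.
generalize (filter_and (F := locally x) _ _ HFG (HF e He)). apply filter_imp.
intros u [H1 H2]. now rewrite <- H1, <- Hx.
Qed.

Lemma cont_Re F x : cont F x -> continuous (fun u => Re (F u)) x.
Proof.
intros HF. apply filterlim_locally. intros e.
generalize (HF e (cond_pos e)). apply filter_imp. intros u Hu.
eapply Rle_lt_trans; [|exact Hu].
exact (re_le_Cmod (F u - F x)).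
Qed.

Lemma cont_Im F x : cont F x -> continuous (fun u => Im (F u)) x.
Proof.
intros HF. apply filterlim_locally. intros e.
generalize (HF e (cond_pos e)). apply filter_imp. intros u Hu.
eapply Rle_lt_trans; [|exact Hu].
exact (im_le_Cmod (F u - F x)).
Qed.

Lemma cont_pair (a b : U -> R) x :
  continuous a x -> continuous b x -> cont (fun u => (a u, b u)) x.
Proof.
intros Ha Hb e He.
assert (He2 : 0 < e / 2) by lra.
generalize (filter_and (F := locally x) _ _
  (proj1 (filterlim_locally _ _) Ha (mkposreal _ He2))
  (proj1 (filterlim_locally _ _) Hb (mkposreal _ He2))).
apply filter_imp. intros u [H1 H2].
eapply Rle_lt_trans; [apply Cmod_le_re_im|].
change (Rabs (a u - a x) < e / 2) in H1.
change (Rabs (b u - b x) < e / 2) in H2.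
simpl. change (Rabs (a u - a x) + Rabs (b u - b x) < e). lra.
Qed.

End Cont.

Lemma cont_id (z : C) : cont (fun w : C => w) z.
Proof. intros e He. apply locally_Cmod. exists e. split; auto. Qed.

Lemma strict_at_cont (f : C -> C) (z d : C) : strict_at f z d -> cont f z.
Proof.
intros Hf e He. apply locally_Cmod.
destruct (Hf 1 Rlt_0_1) as [r [Hr H]].
pose proof (Cmod_ge_0 d) as Hd.
assert (0 < e / (2 + Cmod d)) by (apply Rdiv_lt_0_compat; lra).
exists (Rmin r (e / (2 + Cmod d))). split; [apply Rmin_pos; lra|].
intros w Hw.
assert (H1 : Cmod (w - z) < r) by (eapply Rlt_le_trans; [exact Hw|apply Rmin_l]).
assert (H2 : Cmod (w - z) < e / (2 + Cmod d))
  by (eapply Rlt_le_trans; [exact Hw|apply Rmin_r]).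
assert (Hzz : Cmod (z - z) < r)
  by (replace (z - z)%C with (RtoC 0) by ring; rewrite Cmod_0; lra).
pose proof (H w z H1 Hzz) as H3.
replace (f w - f z)%C with ((f w - f z - d * (w - z)) + d * (w - z))%C by ring.
eapply Rle_lt_trans; [apply Cmod_triangle|]. rewrite Cmod_mult.
apply (Rmult_lt_compat_r (2 + Cmod d)) in H2; [|lra].
unfold Rdiv in H2. rewrite Rmult_assoc, Rinv_l, Rmult_1_r in H2 by lra.
pose proof (Cmod_ge_0 (w - z)). nra.
Qed.

(** For [w] near [z], both strict estimates, the one at [w] and the one at [z], apply to the same
    pair [(v, w)] with [v] close to [w]. Their difference bounds [f' w - f' z]. *)
Lemma strict_at_derivative_cont (f f' : C -> C) (z : C) :
  locally z (fun w => strict_at f w (f' w)) -> cont f' z.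
Proof.
intros Hf e He. pose proof (locally_singleton _ _ Hf) as Hz.
apply locally_Cmod in Hf. destruct Hf as [r [Hr Hf]].
apply locally_Cmod.
destruct (Hz (e / 3) ltac:(lra)) as [r1 [Hr1 H1]].
exists (Rmin r r1). split; [apply Rmin_pos; lra|]. intros w Hw.
assert (Hwr : Cmod (w - z) < r) by (eapply Rlt_le_trans; [exact Hw|apply Rmin_l]).
assert (Hwr1 : Cmod (w - z) < r1) by (eapply Rlt_le_trans; [exact Hw|apply Rmin_r]).
destruct (Hf w Hwr (e / 3) ltac:(lra)) as [r2 [Hr2 H2]].
set (h := Rmin (r2 / 2) ((r1 - Cmod (w - z)) / 2)).
assert (Hh : 0 < h) by (apply Rmin_pos; lra).
assert (Hh1 : h <= r2 / 2) by apply Rmin_l.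
assert (Hh2 : h <= (r1 - Cmod (w - z)) / 2) by apply Rmin_r.
set (v := (w + RtoC h)%C).
assert (Ev : (v - w = RtoC h)%C) by (unfold v; ring).
assert (Mv : Cmod (v - w) = h) by (rewrite Ev, Cmod_R; apply Rabs_pos_eq; lra).
assert (M0 : Cmod (w - w) = 0)
  by (replace (w - w)%C with (RtoC 0) by ring; apply Cmod_0).
assert (Mvz : Cmod (v - z) < r1).
{ eapply Rle_lt_trans; [apply (Cmod_sub_triangle w)|]. lra. }
specialize (H1 v w Mvz Hwr1). specialize (H2 v w ltac:(lra) ltac:(lra)).
rewrite Mv in H1, H2.
assert (H3 : Cmod ((f' w - f' z) * (v - w)) <= 2 * (e / 3) * h).
{ replace ((f' w - f' z) * (v - w))%C
    with ((f v - f w - f' z * (v - w)) - (f v - f w - f' w * (v - w)))%C by ring.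
  unfold Cminus at 1. eapply Rle_trans; [apply Cmod_triangle|].
  rewrite Cmod_opp. lra. }
rewrite Cmod_mult, Mv in H3.
apply Rmult_le_reg_r in H3; lra.
Qed.

(** This shape covers at once a translation to the origin and the subtraction of an affine map, as
    in the remainder of a nearly linear function. *)
Lemma strict_at_affine (f : C -> C) (z0 d b p q m : C) :
  strict_at f (b + z0)%C d ->
  strict_at (fun z => p * f (b + z) + q * z + m)%C z0 (p * d + q)%C.
Proof.
intros Hf e He. pose proof (Cmod_ge_0 p) as Hp.
destruct (Hf (e / (1 + Cmod p))) as [r [Hr H]];
  [apply Rdiv_lt_0_compat; lra|].
exists r. split; [exact Hr|]. intros z w Hz Hw.
assert (H1 : Cmod (p * (f (b + z) - f (b + w) - d * (z - w)))%C
   <= e * Cmod (z - w)).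
{ rewrite Cmod_mult. specialize (H (b + z)%C (b + w)%C).
  replace (b + z - (b + z0))%C with (z - z0)%C in H by ring.
  replace (b + w - (b + z0))%C with (w - z0)%C in H by ring.
  replace (b + z - (b + w))%C with (z - w)%C in H by ring.
  specialize (H Hz Hw).
  apply Rle_trans with ((1 + Cmod p) * (e / (1 + Cmod p) * Cmod (z - w))).
  - apply Rmult_le_compat; auto using Cmod_ge_0. lra.
  - right. field. lra. }
replace (p * f (b + z) + q * z + m - (p * f (b + w) + q * w + m)
   - (p * d + q) * (z - w))%C
  with (p * (f (b + z) - f (b + w) - d * (z - w)))%C by ring.
exact H1.
Qed.

Lemma strict_at_inv (z0 : C) : z0 <> 0%C -> strict_at Cinv z0 (- / (z0 * z0))%C.
Proof.
intros Hz0 e He. apply Cmod_gt_0 in Hz0. set (m := Cmod z0) in *.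
(* The numerator below is at most [3 m d] and the denominator at least [m^4 / 4], which gives
   [12 d / m^3 <= e]. *)
set (d := Rmin (m / 2) (e * m * m * m / 12)).
assert (Hmmm : 0 < e * m * m * m) by (repeat apply Rmult_lt_0_compat; lra).
assert (Hd : 0 < d) by (apply Rmin_pos; lra).
assert (Hd1 : d <= m / 2) by apply Rmin_l.
assert (Hd2 : d <= e * m * m * m / 12) by apply Rmin_r.
exists d. split; [exact Hd|]. intros z w Hz Hw.
assert (Hlow : forall v, Cmod (v - z0) < d -> m / 2 <= Cmod v <= 3 * m / 2).
{ intros v Hv. pose proof (Cmod_reverse_triangle z0 v) as A.
  rewrite Cmod_sub_sym in A. pose proof (Cmod_reverse_triangle v z0) as B.
  fold m in A, B. lra. }
destruct (Hlow z Hz) as [Mz Mz']. destruct (Hlow w Hw) as [Mw Mw'].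
assert (Nz : z <> 0%C) by (apply Cmod_neq_0; lra).
assert (Nw : w <> 0%C) by (apply Cmod_neq_0; lra).
assert (Nz0 : z0 <> 0%C) by (apply Cmod_neq_0; exact Hz0).
replace (/ z - / w - - / (z0 * z0) * (z - w))%C
  with ((z - w) * (z * (w - z0) + z0 * (z - z0)) * / (z * w * (z0 * z0)))%C
  by (field; auto).
assert (Nd : (z * w * (z0 * z0))%C <> 0%C)
  by (repeat apply Cmult_neq_0; auto).
rewrite !Cmod_mult, Cmod_inv by exact Nd. rewrite !Cmod_mult. fold m.
assert (HN : Cmod (z * (w - z0) + z0 * (z - z0))%C <= 3 * m * d).
{ eapply Rle_trans; [apply Cmod_triangle|]. rewrite !Cmod_mult. fold m.
  pose proof (Cmod_ge_0 (z - z0)). pose proof (Cmod_ge_0 (w - z0)). nra. }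
assert (HD : m * m * m * m / 4 <= Cmod z * Cmod w * (m * m)).
{ replace (m * m * m * m / 4) with ((m / 2 * (m / 2)) * (m * m)) by field.
  apply Rmult_le_compat_r; [nra|]. apply Rmult_le_compat; lra. }
assert (HDp : 0 < m * m * m * m / 4)
  by (apply Rdiv_lt_0_compat; [repeat apply Rmult_lt_0_compat|]; lra).
rewrite Rmult_assoc, Rmult_comm.
apply Rmult_le_compat_r; [apply Cmod_ge_0|].
apply Rle_trans with (3 * m * d * / (m * m * m * m / 4)).
- apply Rmult_le_compat; auto using Cmod_ge_0.
  + left. apply Rinv_0_lt_compat. lra.
  + apply Rinv_le_contravar; lra.
- apply (Rmult_le_reg_r (m * m * m * m / 4)); [lra|].
  rewrite Rmult_assoc, Rinv_l, Rmult_1_r by lra.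
  apply Rle_trans with (3 * m * (e * m * m * m / 12)).
  + apply Rmult_le_compat_l; lra.
  + right. field.
Qed.

(** * Integrals over the circle *)

Lemma is_derive_iff_eps (g : R -> R) (t l : R) :
  is_derive g t l <->
  forall eps : R, 0 < eps -> exists delta : R, 0 < delta /\
    forall s : R, Rabs (s - t) < delta ->
      Rabs (g s - g t - l * (s - t)) <= eps * Rabs (s - t).
Proof.
split.
- intros [_ H] e He.
  destruct (H t (fun P HP => HP) (mkposreal e He)) as [d Hd].
  exists d. split; [apply cond_pos|]. intros s Hs.
  specialize (Hd s Hs).
  change (Rabs ((g s - g t) - (s - t) * l) <= e * Rabs (s - t)) in Hd.
  now rewrite (Rmult_comm l).
- intros H. split; [apply is_linear_scal_l|].
  intros x Hx e.
  apply (is_filter_lim_locally_unique (V := AbsRing_NormedModule R_AbsRing)) in Hx.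
  subst x.
  destruct (H e (cond_pos e)) as [d [Hd Hd']].
  exists (mkposreal d Hd). intros s Hs.
  change (Rabs ((g s - g t) - (s - t) * l) <= e * Rabs (s - t)).
  rewrite (Rmult_comm _ l). now apply Hd'.
Qed.

Definition cderiv (F : R -> C) (t : R) (d : C) : Prop :=
  is_derive (fun s => Re (F s)) t (Re d) /\ is_derive (fun s => Im (F s)) t (Im d).

Lemma cderiv_iff_eps (F : R -> C) (t : R) (d : C) :
  cderiv F t d <->
  forall eps : R, 0 < eps -> exists delta : R, 0 < delta /\
    forall s : R, Rabs (s - t) < delta ->
      Cmod (F s - F t - d * RtoC (s - t)) <= eps * Rabs (s - t).
Proof.
unfold cderiv. rewrite !is_derive_iff_eps. split.
- intros [HR HI] e He.
  destruct (HR (e / 2) ltac:(lra)) as [d1 [Hd1 H1]].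
  destruct (HI (e / 2) ltac:(lra)) as [d2 [Hd2 H2]].
  exists (Rmin d1 d2). split; [now apply Rmin_pos|]. intros s Hs.
  specialize (H1 s (Rlt_le_trans _ _ _ Hs (Rmin_l _ _))).
  specialize (H2 s (Rlt_le_trans _ _ _ Hs (Rmin_r _ _))).
  eapply Rle_trans; [apply Cmod_le_re_im|].
  destruct (F s) as [a b], (F t) as [a' b'], d as [p q]. simpl in *.
  replace (a + - a' + - (p * (s - t) - q * 0)) with (a - a' - p * (s - t)) by ring.
  replace (b + - b' + - (p * 0 + q * (s - t))) with (b - b' - q * (s - t)) by ring.
  lra.
- intros H. split; intros e He; destruct (H e He) as [r [Hr H1]];
    exists r; (split; [exact Hr|]); intros s Hs;
    specialize (H1 s Hs); (eapply Rle_trans; [|exact H1]).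
  + eapply Rle_trans; [|apply re_le_Cmod]. right. f_equal.
    destruct (F s) as [a b], (F t) as [a' b'], d as [p q]. simpl. ring.
  + eapply Rle_trans; [|apply im_le_Cmod]. right. f_equal.
    destruct (F s) as [a b], (F t) as [a' b'], d as [p q]. simpl. ring.
Qed.

Lemma cderiv_cont (F : R -> C) (t : R) (d : C) : cderiv F t d -> cont F t.
Proof.
intros [HR HI].
apply cont_ext_loc with (fun s => (Re (F s), Im (F s))).
{ apply filter_forall. intros s. symmetry. apply surjective_pairing. }
apply cont_pair; (apply (ex_derive_continuous (V := R_NormedModule)));
  eexists; eassumption.
Qed.

Lemma cderiv_comp (f : C -> C) (F : R -> C) (t : R) (d d' : C) :
  strict_at f (F t) d -> cderiv F t d' -> cderiv (fun s => f (F s)) t (d * d')%C.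
Proof.
intros Hf HF. pose proof (cderiv_cont _ _ _ HF) as HcF.
rewrite cderiv_iff_eps in HF |- *. intros e He.
pose proof (Cmod_ge_0 d) as Hd. pose proof (Cmod_ge_0 d') as Hd'.
destruct (Hf (e / (2 * (1 + Cmod d')))) as [r1 [Hr1 H1]];
  [apply Rdiv_lt_0_compat; lra|].
assert (Hc : 0 < Rmin 1 (e / (2 * (1 + Cmod d))))
  by (apply Rmin_pos; [lra|apply Rdiv_lt_0_compat; lra]).
destruct (HF _ Hc) as [r2 [Hr2 H2]].
destruct (HcF r1 Hr1) as [r3 H3].
exists (Rmin r2 r3). split; [apply Rmin_pos; [lra|apply cond_pos]|].
intros s Hs.
specialize (H2 s (Rlt_le_trans _ _ _ Hs (Rmin_l _ _))).
specialize (H3 s (Rlt_le_trans _ _ _ Hs (Rmin_r _ _))).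
assert (H0 : Cmod (F t - F t) < r1)
  by (replace (F t - F t)%C with (RtoC 0) by ring; now rewrite Cmod_0).
specialize (H1 _ _ H3 H0).
pose proof (Rabs_pos (s - t)) as Hst.
set (x := Rabs (s - t)) in *.
assert (HFF : Cmod (F s - F t) <= (1 + Cmod d') * x).
{ replace (F s - F t)%C
    with ((F s - F t - d' * RtoC (s - t)) + d' * RtoC (s - t))%C by ring.
  eapply Rle_trans; [apply Cmod_triangle|].
  rewrite Cmod_mult, Cmod_R. fold x.
  pose proof (Rmin_l 1 (e / (2 * (1 + Cmod d)))). nra. }
replace (f (F s) - f (F t) - d * d' * RtoC (s - t))%C
  with ((f (F s) - f (F t) - d * (F s - F t))
        + d * (F s - F t - d' * RtoC (s - t)))%C by ring.
eapply Rle_trans; [apply Cmod_triangle|]. rewrite (Cmod_mult d).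
assert (A1 : Cmod (f (F s) - f (F t) - d * (F s - F t)) <= e / 2 * x).
{ eapply Rle_trans; [exact H1|].
  apply Rle_trans with (e / (2 * (1 + Cmod d')) * ((1 + Cmod d') * x)).
  - apply Rmult_le_compat_l; [|exact HFF]. left. apply Rdiv_lt_0_compat; lra.
  - right. field. lra. }
assert (A2 : Cmod d * Cmod (F s - F t - d' * RtoC (s - t)) <= e / 2 * x).
{ apply Rle_trans with ((1 + Cmod d) * (e / (2 * (1 + Cmod d)) * x)).
  - apply Rmult_le_compat; [lra|apply Cmod_ge_0|lra|].
    eapply Rle_trans; [exact H2|]. apply Rmult_le_compat_r; [lra|apply Rmin_r].
  - right. field. lra. }
lra.
Qed.

Lemma cderiv_scal (F : R -> C) (t : R) (d a : C) :
  cderiv F t d -> cderiv (fun s => F s * a)%C t (d * a)%C.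
Proof.
intros HF. rewrite cderiv_iff_eps in HF |- *. intros e He.
pose proof (Cmod_ge_0 a) as Ha.
destruct (HF (e / (1 + Cmod a))) as [r [Hr H]]; [apply Rdiv_lt_0_compat; lra|].
exists r. split; [exact Hr|]. intros s Hs. specialize (H s Hs).
replace (F s * a - F t * a - d * a * RtoC (s - t))%C
  with ((F s - F t - d * RtoC (s - t)) * a)%C by ring.
rewrite Cmod_mult.
apply Rle_trans with (e / (1 + Cmod a) * Rabs (s - t) * (1 + Cmod a)).
- apply Rmult_le_compat; auto using Cmod_ge_0. lra.
- right. field. lra.
Qed.

Lemma cderiv_affine (a b : C) (t : R) : cderiv (fun s => a + RtoC s * b)%C t b.
Proof.
rewrite cderiv_iff_eps. intros e He. exists 1. split; [lra|]. intros s _.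
replace (a + RtoC s * b - (a + RtoC t * b) - b * RtoC (s - t))%C with (RtoC 0)
  by (rewrite RtoC_minus; ring).
rewrite Cmod_0. apply Rmult_le_pos; [lra|apply Rabs_pos].
Qed.

Lemma cderiv_affine_comp (F : R -> C) (t : R) (d a b : C) :
  cderiv F t d -> cderiv (fun s => a + b * F s)%C t (b * d)%C.
Proof.
intros HF. apply (cderiv_scal _ _ _ b) in HF.
rewrite cderiv_iff_eps in HF |- *. intros e He.
destruct (HF e He) as [r [Hr H]]. exists r. split; [exact Hr|].
intros s Hs. specialize (H s Hs).
replace (a + b * F s - (a + b * F t) - b * d * RtoC (s - t))%C
  with (F s * b - F t * b - d * b * RtoC (s - t))%C by ring.
exact H.
Qed.

Lemma cderiv_polar (r t : R) : cderiv (polar r) t (Ci * polar r t)%C.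
Proof.
unfold polar, Ci. split; simpl; auto_derive; auto; ring.
Qed.

Lemma polar_0_2PI (r : R) : polar r (2 * PI) = polar r 0.
Proof. unfold polar. now rewrite cos_2PI, sin_2PI, cos_0, sin_0. Qed.

(** * Integrals over one period and their dependence on a parameter *)

Definition CInt (F : R -> C) : C :=
  (RInt (fun t => Re (F t)) 0 (2 * PI), RInt (fun t => Im (F t)) 0 (2 * PI)).

Lemma cont_ex_RInt_Re (F : R -> C) (a b : R) :
  (forall t, cont F t) -> ex_RInt (fun t => Re (F t)) a b.
Proof.
intros HF. apply (ex_RInt_continuous (V := R_CompleteNormedModule)).
intros t _. apply cont_Re, HF.
Qed.

Lemma cont_ex_RInt_Im (F : R -> C) (a b : R) :
  (forall t, cont F t) -> ex_RInt (fun t => Im (F t)) a b.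
Proof.
intros HF. apply (ex_RInt_continuous (V := R_CompleteNormedModule)).
intros t _. apply cont_Im, HF.
Qed.

Lemma CInt_ext (F G : R -> C) : (forall t, F t = G t) -> CInt F = CInt G.
Proof.
intros H. unfold CInt. f_equal; apply RInt_ext; intros t _; now rewrite H.
Qed.

Lemma CInt_plus (F G : R -> C) :
  (forall t, cont F t) -> (forall t, cont G t) ->
  CInt (fun t => F t + G t)%C = (CInt F + CInt G)%C.
Proof.
intros HF HG. unfold CInt, Cplus; simpl. f_equal;
  apply (RInt_plus (V := R_CompleteNormedModule));
  auto using cont_ex_RInt_Re, cont_ex_RInt_Im.
Qed.

Lemma CInt_scal (F : R -> C) (a : C) :
  (forall t, cont F t) -> CInt (fun t => a * F t)%C = (a * CInt F)%C.
Proof.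
intros HF. pose proof (cont_ex_RInt_Re F 0 (2 * PI) HF) as HR.
pose proof (cont_ex_RInt_Im F 0 (2 * PI) HF) as HI.
assert (HscR : forall k, ex_RInt (fun t => k * Re (F t)) 0 (2 * PI))
  by (intros k; now apply (ex_RInt_scal (V := R_NormedModule))).
assert (HscI : forall k, ex_RInt (fun t => k * Im (F t)) 0 (2 * PI))
  by (intros k; now apply (ex_RInt_scal (V := R_NormedModule))).
assert (ER : forall k, RInt (fun t => k * Re (F t)) 0 (2 * PI)
  = k * RInt (fun t => Re (F t)) 0 (2 * PI))
  by (intros k; now apply (RInt_scal (V := R_CompleteNormedModule))).
assert (EI : forall k, RInt (fun t => k * Im (F t)) 0 (2 * PI)
  = k * RInt (fun t => Im (F t)) 0 (2 * PI))
  by (intros k; now apply (RInt_scal (V := R_CompleteNormedModule))).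
unfold CInt, Cmult at 3; simpl. f_equal.
- rewrite <- ER, <- EI.
  now apply (RInt_minus (V := R_CompleteNormedModule)).
- rewrite <- ER, <- EI.
  now apply (RInt_plus (V := R_CompleteNormedModule)).
Qed.

Lemma CInt_const (a : C) : CInt (fun _ => a) = (RtoC (2 * PI) * a)%C.
Proof.
unfold CInt. rewrite !RInt_const. unfold scal, mult, RtoC, Cmult; simpl.
change (@mult R_AbsRing) with Rmult. unfold Re, Im. f_equal; ring.
Qed.

(* The two components are bounded separately, which doubles the optimal
   constant. *)
Lemma CInt_bound (F : R -> C) (M : R) :
  (forall t, cont F t) -> (forall t, Cmod (F t) <= M) ->
  Cmod (CInt F) <= 4 * PI * M.
Proof.
intros HF HM. pose proof PI_RGT_0 as HPI.
assert (B : forall g : R -> R, ex_RInt g 0 (2 * PI) ->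
   (forall t, Rabs (g t) <= M) -> Rabs (RInt g 0 (2 * PI)) <= 2 * PI * M).
{ intros g Hg Hb.
  pose proof (norm_RInt_le_const (V := R_CompleteNormedModule) g 0 (2 * PI)
    (RInt g 0 (2 * PI)) M ltac:(lra) (fun t _ => Hb t)
    (RInt_correct (V := R_CompleteNormedModule) _ _ _ Hg)) as H.
  rewrite Rminus_0_r in H. exact H. }
eapply Rle_trans; [apply Cmod_le_re_im|]. simpl.
pose proof (B _ (cont_ex_RInt_Re F 0 (2 * PI) HF)
  (fun t => Rle_trans _ _ _ (re_le_Cmod _) (HM t))) as B1.
pose proof (B _ (cont_ex_RInt_Im F 0 (2 * PI) HF)
  (fun t => Rle_trans _ _ _ (im_le_Cmod _) (HM t))) as B2.
unfold Re, Im in *. lra.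
Qed.

Lemma CInt_derivative_periodic (F F' : R -> C) :
  (forall t, cderiv F t (F' t)) -> (forall t, cont F' t) ->
  F (2 * PI) = F 0 -> CInt F' = 0%C.
Proof.
intros HF HF' HP. unfold CInt, RtoC. f_equal; apply is_RInt_unique.
- replace 0 with (minus (Re (F (2 * PI))) (Re (F 0))) at 2
    by (rewrite HP; apply (minus_eq_zero (G := R_AbelianGroup))).
  apply (is_RInt_derive (V := R_CompleteNormedModule) (fun t => Re (F t))).
  + intros t _. apply HF.
  + intros t _. apply cont_Re, HF'.
- replace 0 with (minus (Im (F (2 * PI))) (Im (F 0))) at 2
    by (rewrite HP; apply (minus_eq_zero (G := R_AbelianGroup))).
  apply (is_RInt_derive (V := R_CompleteNormedModule) (fun t => Im (F t))).
  + intros t _. apply HF.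
  + intros t _. apply cont_Im, HF'.
Qed.

(** Differentiation under the integral sign. The margin [tau] provides a neighbourhood of each [t]
    in [[0, 1]], endpoints included, on which the integrand is differentiable. *)
Lemma RInt_param_constant (h h' : R -> R -> R) (tau a b : R) :
  0 < tau ->
  (forall t th, - tau < t < 1 + tau -> is_derive (fun s => h s th) t (h' t th)) ->
  (forall t th, - tau < t < 1 + tau -> continuity_2d_pt h' t th) ->
  (forall t, - tau < t < 1 + tau -> ex_RInt (h t) a b) ->
  (forall t, 0 <= t <= 1 -> RInt (h' t) a b = 0) ->
  RInt (h 1) a b = RInt (h 0) a b.
Proof.
intros Htau Hd Hc Hi H0. symmetry.
apply (eq_is_derive (V := R_NormedModule) (fun t => RInt (h t) a b) 0 1); [|lra].
intros t Ht.
assert (Hloc : locally t (fun s => - tau < s < 1 + tau)).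
{ assert (Hm : 0 < tau) by lra. exists (mkposreal tau Hm). intros s Hs.
  change (Rabs (s - t) < tau) in Hs. apply Rabs_def2 in Hs. lra. }
assert (E : forall s v, - tau < s < 1 + tau ->
   Derive (fun u => h u v) s = h' s v)
  by (intros s v Hs; apply is_derive_unique, Hd, Hs).
change (@zero R_NormedModule) with 0.
rewrite <- (H0 t Ht).
rewrite <- (RInt_ext (fun v => Derive (fun u => h u v) t));
  [|intros v _; apply E; lra].
apply is_derive_RInt_param.
- revert Hloc. apply filter_imp. intros s Hs v _. eexists. now apply Hd.
- intros v _. apply continuity_2d_pt_ext_loc with h'; [|apply Hc; lra].
  destruct Hloc as [r Hr]. exists r. intros u w Hu _. symmetry. apply E.
  apply Hr, Hu.
- revert Hloc. apply filter_imp. intros s Hs. now apply Hi.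
Qed.

Lemma CInt_param_constant (h h' : R -> R -> C) (tau : R) :
  0 < tau ->
  (forall t th, - tau < t < 1 + tau -> cderiv (fun s => h s th) t (h' t th)) ->
  (forall t th, - tau < t < 1 + tau ->
     cont (fun u : R * R => h' (fst u) (snd u)) (t, th)) ->
  (forall t th, - tau < t < 1 + tau -> cont (h t) th) ->
  (forall t, 0 <= t <= 1 -> CInt (h' t) = 0%C) ->
  CInt (h 1) = CInt (h 0).
Proof.
intros Htau Hd Hc Hi H0. unfold CInt. f_equal.
- apply (RInt_param_constant (fun t th => Re (h t th)) (fun t th => Re (h' t th))
    tau); auto.
  + intros t th Ht. now apply Hd.
  + intros t th Ht. apply continuity_2d_pt_filterlim.
    apply (cont_Re (fun u : R * R => h' (fst u) (snd u))), Hc, Ht.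
  + intros t Ht. apply cont_ex_RInt_Re. auto.
  + intros t Ht. exact (f_equal fst (H0 t Ht)).
- apply (RInt_param_constant (fun t th => Im (h t th)) (fun t th => Im (h' t th))
    tau); auto.
  + intros t th Ht. now apply Hd.
  + intros t th Ht. apply continuity_2d_pt_filterlim.
    apply (cont_Im (fun u : R * R => h' (fst u) (snd u))), Hc, Ht.
  + intros t Ht. apply cont_ex_RInt_Im. auto.
  + intros t Ht. exact (f_equal snd (H0 t Ht)).
Qed.

(** * Cauchy's formula *)

Lemma cont_polar_comp {U : UniformSpace} (g : U -> R) (r : R) (x : U) :
  continuous g x -> cont (fun u => polar r (g u)) x.
Proof.
intros Hg.
(* [cont_comp] composes with maps defined on [C], so the real angle passes through its embedding. *)
apply cont_comp with (f := fun z => polar r (Re z)) (F := fun u => RtoC (g u)).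
- apply cont_pair; apply (continuous_comp Re (fun t => r * _ t)).
  + apply cont_Re, cont_id.
  + apply (ex_derive_continuous (V := R_NormedModule)). now auto_derive.
  + apply cont_Re, cont_id.
  + apply (ex_derive_continuous (V := R_NormedModule)). now auto_derive.
- apply cont_pair; [exact Hg|apply continuous_const].
Qed.

Lemma cont_polar (r t : R) : cont (polar r) t.
Proof. apply (cderiv_cont _ _ _ (cderiv_polar r t)). Qed.

(* The integrand's t-derivative, [lambda zeta F'(gamma)], is also a
   theta-derivative of a periodic function. *)
Lemma circle_homotopy (F F' : C -> C) (W : R -> C) (r tau : R)
  (p q m n lambda : C) :
  let gamma t th := (p + m * polar r th + RtoC t * (q + n * polar r th))%C in
  0 < tau ->
  (forall t th, - tau < t < 1 + tau ->
     locally (gamma t th) (fun w => strict_at F w (F' w))) ->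
  (forall th, cont W th) ->
  (forall th, ((q + n * polar r th) * W th = lambda * polar r th)%C) ->
  CInt (fun th => F (gamma 1 th) * W th)%C
  = CInt (fun th => F (gamma 0 th) * W th)%C.
Proof.
intros gamma Htau HF HW HqW.
assert (HF1 : forall t th, - tau < t < 1 + tau ->
   strict_at F (gamma t th) (F' (gamma t th)))
  by (intros t th Ht; exact (locally_singleton _ _ (HF t th Ht))).
assert (HcF' : forall t th, - tau < t < 1 + tau -> cont F' (gamma t th)).
{ intros t th Ht. apply strict_at_derivative_cont with F. now apply HF. }
assert (Hg : forall t th, cderiv (gamma t) th ((m + RtoC t * n) * (Ci * polar r th))%C).
{ intros t th.
  pose proof (cderiv_affine_comp _ th _ (p + RtoC t * q)%C (m + RtoC t * n)%C
    (cderiv_polar r th)) as H.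
  rewrite cderiv_iff_eps in H |- *. intros e He.
  destruct (H e He) as [d [Hd H']]. exists d. split; [exact Hd|].
  intros s Hs.
  assert (E : forall x, gamma t x
    = (p + RtoC t * q + (m + RtoC t * n) * polar r x)%C)
    by (intros x; unfold gamma; ring).
  rewrite !E. now apply H'. }
apply (CInt_param_constant (fun t th => F (gamma t th) * W th)%C
  (fun t th => F' (gamma t th) * (lambda * polar r th))%C tau); auto.
(* The [t]-derivative of [gamma] is [q + n * polar r th]; its product with [W] is
   [lambda * polar r th]. *)
- intros t th Ht. rewrite <- HqW, Cmult_assoc.
  apply cderiv_scal, cderiv_comp; [now apply HF1|]. apply cderiv_affine.
- intros t th Ht.
  assert (cont (fun u : R * R => polar r (snd u)) (t, th))
    by (apply cont_polar_comp, continuous_snd).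
  assert (cont (fun u : R * R => RtoC (fst u)) (t, th))
    by (apply cont_pair; [apply continuous_fst|apply continuous_const]).
  apply cont_mult.
  + apply cont_comp; [now apply HcF'|].
    apply cont_plus; [|apply cont_mult; [assumption|]];
      apply cont_plus; auto using cont_const; apply cont_mult; auto using cont_const.
  + apply cont_mult; auto using cont_const.
- intros t th Ht. apply cont_mult; [|apply HW]. apply cont_comp.
  + eapply strict_at_cont. now apply HF1.
  + eapply cderiv_cont. apply Hg.
- intros t Ht.
  assert (HcontP : forall th, cont (fun x => F' (gamma t x) * (lambda * polar r x))%C th).
  { intros th. apply cont_mult.
    - apply cont_comp; [apply HcF'; lra|]. eapply cderiv_cont. apply Hg.
    - apply cont_mult; [apply cont_const|apply cont_polar]. }
  (* For fixed [t] the curve is a circle about [p + t q], scaled by [m + t n]. If this factor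
     vanishes the curve is a point and the integrand a multiple of [polar r th]; otherwise
     [F (gamma t th)], divided by the factor and by [Ci], supplies the antiderivative. *)
  destruct (excluded_middle_informative (m + RtoC t * n = 0)%C) as [E|E].
  + set (K := (F' (p + RtoC t * q) * lambda)%C).
    rewrite (CInt_ext _ (fun th => K * polar r th)%C).
    * apply (CInt_derivative_periodic (fun th => 0 + (- Ci * K) * polar r th)%C).
      -- intros th.
         replace (K * polar r th)%C with ((- Ci * K) * (Ci * polar r th))%C.
         ++ apply cderiv_affine_comp, cderiv_polar.
         ++ transitivity (- (Ci * Ci) * K * polar r th)%C; [ring|].
            replace (Ci * Ci)%C with (- (1))%C; [ring|].
            unfold Ci, Cmult, Copp, RtoC; simpl; f_equal; ring.
      -- intros th. apply cont_mult; [apply cont_const|apply cont_polar].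
      -- now rewrite polar_0_2PI.
    * intros th. unfold gamma, K.
      replace (p + m * polar r th + RtoC t * (q + n * polar r th))%C
        with (p + RtoC t * q + (m + RtoC t * n) * polar r th)%C by ring.
      rewrite E, Cmult_0_l, Cplus_0_r. ring.
  + assert (HCi : Ci <> 0%C)
      by (intros H; apply (f_equal snd) in H; simpl in H; lra).
    apply (CInt_derivative_periodic
      (fun th => F (gamma t th) * (lambda / (Ci * (m + RtoC t * n))))%C).
    * intros th.
      replace (F' (gamma t th) * (lambda * polar r th))%C
        with (F' (gamma t th) * ((m + RtoC t * n) * (Ci * polar r th))
              * (lambda / (Ci * (m + RtoC t * n))))%C
        by (field; auto).
      apply cderiv_scal, cderiv_comp; [apply HF1; lra|apply Hg].
    * exact HcontP.
    * unfold gamma. now rewrite polar_0_2PI.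
Qed.

Lemma polar_sub_neq_0 (r th : R) (z : C) : Cmod z < r -> (polar r th - z)%C <> 0%C.
Proof.
intros Hz. apply Cmod_neq_0. pose proof (Cmod_ge_0 z).
pose proof (Cmod_reverse_triangle (polar r th) z) as H1.
rewrite Cmod_polar in H1; lra.
Qed.

Lemma polar_neq_0 (r th : R) : 0 < r -> polar r th <> 0%C.
Proof. intros Hr. apply Cmod_neq_0. now rewrite Cmod_polar. Qed.

Lemma cont_inv_comp {U : UniformSpace} (F : U -> C) (x : U) :
  F x <> 0%C -> cont F x -> cont (fun u => / F u)%C x.
Proof.
intros H HF. apply cont_comp; [|exact HF].
eapply strict_at_cont, strict_at_inv, H.
Qed.

Lemma cont_kernel (r th : R) (z : C) : Cmod z < r ->
  cont (fun t => polar r t / (polar r t - z))%C th.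
Proof.
intros Hz. apply cont_mult; [apply cont_polar|].
apply cont_inv_comp; [now apply polar_sub_neq_0|].
apply cont_plus; [apply cont_polar|apply cont_const].
Qed.

(** Cauchy's formula for the constant 1. The homotopy [polar r th - t z] moves the pole from [z] to
    the centre, where the integrand is identically 1. *)
Lemma CInt_kernel (r : R) (z : C) : Cmod z < r ->
  CInt (fun th => polar r th / (polar r th - z))%C = RtoC (2 * PI).
Proof.
intros Hz. pose proof (Cmod_ge_0 z) as Hz0. assert (Hr : 0 < r) by lra.
(* Chosen so that [(1 + tau) |z| < r]: the moving pole stays inside the circle. *)
set (tau := (r - Cmod z) / (2 * r)).
assert (Htau : 0 < tau) by (apply Rdiv_lt_0_compat; lra).
assert (Etau : tau * r = (r - Cmod z) / 2) by (unfold tau; field; lra).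
assert (HW : forall th, ((- z + 0 * polar r th) * polar r th = - z * polar r th)%C)
  by (intros; ring).
pose proof (circle_homotopy Cinv (fun w => - / (w * w))%C (polar r) r tau
  0%C (- z)%C 1%C 0%C (- z)%C Htau) as H. cbv beta zeta in H.
rewrite (CInt_ext _ (fun th =>
  / (0 + 1 * polar r th + RtoC 1 * (- z + 0 * polar r th)) * polar r th)%C).
2:{ intros th. unfold Cdiv. rewrite Cmult_comm. f_equal. f_equal. ring. }
rewrite H; auto using cont_polar.
- rewrite (CInt_ext _ (fun _ => 1%C)).
  + rewrite CInt_const. ring.
  + intros th.
    replace (0 + 1 * polar r th + RtoC 0 * (- z + 0 * polar r th))%C
      with (polar r th) by ring.
    apply Cinv_l. now apply polar_neq_0.
- intros t th Ht.
  set (w0 := (0 + 1 * polar r th + RtoC t * (- z + 0 * polar r th))%C).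
  assert (Hw0 : 0 < Cmod w0).
  { replace w0 with (polar r th - RtoC t * z)%C by (unfold w0; ring).
    pose proof (Cmod_reverse_triangle (polar r th) (RtoC t * z)) as A.
    rewrite Cmod_mult, Cmod_R, Cmod_polar in A by exact Hr.
    assert (Rabs t <= 1 + tau) by (apply Rabs_le; lra).
    assert (Rabs t * Cmod z <= (1 + tau) * Cmod z)
      by (apply Rmult_le_compat_r; lra).
    nra. }
  apply locally_Cmod. exists (Cmod w0). split; [exact Hw0|].
  intros w Hw. apply strict_at_inv. intros E. subst w.
  rewrite Cmod_sub_sym in Hw. replace (w0 - 0)%C with w0 in Hw by ring. lra.
Qed.

Lemma strict_at_choice (D : C -> Prop) (f : C -> C) :
  (forall z, D z -> exists d, strict_at f z d) ->
  exists f' : C -> C, forall z, D z -> strict_at f z (f' z).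
Proof.
intros H. exists (fun z => epsilon (inhabits (RtoC 0)) (strict_at f z)).
intros z Hz. apply epsilon_spec. auto.
Qed.

(** The circle is contracted to [z] along [z + t (polar r th - z)] while the kernel is kept fixed.
    At [t = 0] the factor [f z] comes out, and [CInt_kernel] evaluates the rest. *)
Theorem Cauchy_formula (f : C -> C) (rad r : R) (z : C) :
  (forall w, Cmod w < rad -> exists d, strict_at f w d) ->
  Cmod z < r < rad ->
  CInt (fun th => f (polar r th) * (polar r th / (polar r th - z)))%C
  = (RtoC (2 * PI) * f z)%C.
Proof.
intros Hf [Hz Hr]. pose proof (Cmod_ge_0 z) as Hz0.
destruct (strict_at_choice _ _ Hf) as [f' Hf'].
(* The points [(1 - t) z + t polar r th] have modulus at most
   [(1 + 2 tau) r = (rad + r) / 2 < rad]. *)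
set (tau := (rad - r) / (4 * r)).
assert (Htau : 0 < tau) by (apply Rdiv_lt_0_compat; lra).
assert (Etau : tau * r = (rad - r) / 4) by (unfold tau; field; lra).
pose proof (circle_homotopy f f' (fun th => polar r th / (polar r th - z))%C
  r tau z (- z)%C 0%C 1%C 1%C Htau) as H. cbv beta zeta in H.
rewrite (CInt_ext _ (fun th =>
  f (z + 0 * polar r th + RtoC 1 * (- z + 1 * polar r th)) *
  (polar r th / (polar r th - z)))%C).
2:{ intros th. f_equal. f_equal. ring. }
rewrite H.
- rewrite (CInt_ext _ (fun th => f z * (polar r th / (polar r th - z)))%C).
  + rewrite CInt_scal by (intros; now apply cont_kernel).
    rewrite CInt_kernel by exact Hz. ring.
  + intros th. f_equal. f_equal. ring.
- intros t th Ht.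
  set (w0 := (z + 0 * polar r th + RtoC t * (- z + 1 * polar r th))%C).
  assert (Hw0 : Cmod w0 < rad).
  { replace w0 with (RtoC (1 - t) * z + RtoC t * polar r th)%C
      by (unfold w0; rewrite RtoC_minus; ring).
    eapply Rle_lt_trans; [apply Cmod_triangle|].
    rewrite !Cmod_mult, !Cmod_R, Cmod_polar by lra.
    assert (Rabs t + Rabs (1 - t) <= 1 + 2 * tau)
      by (unfold Rabs; destruct (Rcase_abs t), (Rcase_abs (1 - t)); lra).
    pose proof (Rabs_pos t). pose proof (Rabs_pos (1 - t)). nra. }
  apply locally_Cmod. exists (rad - Cmod w0). split; [lra|].
  intros w Hw. apply Hf'.
  pose proof (Cmod_reverse_triangle w w0). lra.
- intros th. now apply cont_kernel.
- intros th. field. now apply polar_sub_neq_0.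
Qed.

Lemma cont_circle (f : C -> C) (rad r th : R) :
  (forall w, Cmod w < rad -> exists d, strict_at f w d) -> 0 < r < rad ->
  cont (fun t => f (polar r t)) th.
Proof.
intros Hf Hr. apply cont_comp; [|apply cont_polar].
destruct (Hf (polar r th)) as [d Hd]; [rewrite Cmod_polar; lra|].
eapply strict_at_cont, Hd.
Qed.

(** Cauchy's formula at [z] and at [w] is subtracted under the integral. On the circle of radius
    [rad / 2] both denominators are at least [rad / 4], so the integrand is at most
    [8 M / rad * |z - w|]; [CInt_bound] doubles this. *)
Lemma Cauchy_lipschitz (f : C -> C) (rad M : R) (z w : C) :
  0 < rad ->
  (forall v, Cmod v < rad -> exists d, strict_at f v d) ->
  (forall v, Cmod v < rad -> Cmod (f v) <= M) ->
  Cmod z <= rad / 4 -> Cmod w <= rad / 4 ->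
  Cmod (f z - f w) <= 16 * M / rad * Cmod (z - w).
Proof.
intros HR Hf HM Hz Hw. pose proof PI_RGT_0 as HPI.
assert (Hr : 0 < rad / 2 < rad) by lra. set (r := rad / 2) in *.
assert (HM0 : 0 <= M).
{ eapply Rle_trans; [apply Cmod_ge_0|apply (HM z)]. lra. }
assert (Hdist : forall v th, Cmod v <= rad / 4 -> rad / 4 <= Cmod (polar r th - v)).
{ intros v th Hv. pose proof (Cmod_reverse_triangle (polar r th) v) as A.
  rewrite Cmod_polar in A by lra. unfold r in *. lra. }
assert (E : (RtoC (2 * PI) * (f z - f w))%C = CInt (fun th => f (polar r th) *
   (polar r th * (z - w) / ((polar r th - z) * (polar r th - w))))%C).
{ replace (RtoC (2 * PI) * (f z - f w))%C
    with (RtoC (2 * PI) * f z + (- (1)) * (RtoC (2 * PI) * f w))%C by ring.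
  rewrite <- (Cauchy_formula f rad r z), <- (Cauchy_formula f rad r w);
    auto; try (unfold r; lra).
  rewrite <- CInt_scal, <- CInt_plus.
  - apply CInt_ext. intros th. field.
    split; apply polar_sub_neq_0; unfold r; lra.
  - intros th. apply cont_mult; [eapply cont_circle; eauto|].
    apply cont_kernel. unfold r; lra.
  - intros th. apply cont_mult; [apply cont_const|].
    apply cont_mult; [eapply cont_circle; eauto|].
    apply cont_kernel. unfold r; lra.
  - intros th. apply cont_mult; [eapply cont_circle; eauto|].
    apply cont_kernel. unfold r; lra. }
assert (B : Cmod (RtoC (2 * PI) * (f z - f w))
  <= 4 * PI * (8 * M / rad * Cmod (z - w))).
{ rewrite E. apply CInt_bound.
  - intros th. apply cont_mult; [eapply cont_circle; eauto|].
    apply cont_mult; [apply cont_mult; [apply cont_polar|apply cont_const]|].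
    apply cont_inv_comp.
    + apply Cmult_neq_0; apply polar_sub_neq_0; unfold r; lra.
    + apply cont_mult; (apply cont_plus; [apply cont_polar|apply cont_const]).
  - intros th.
    pose proof (Hdist z th Hz) as Dz. pose proof (Hdist w th Hw) as Dw.
    rewrite Cmod_mult, Cmod_div, !Cmod_mult, Cmod_polar
      by (try apply Cmult_neq_0; try apply polar_sub_neq_0; unfold r; lra).
    pose proof (Cmod_ge_0 (z - w)) as Hzw.
    apply Rle_trans with (M * (r * Cmod (z - w) / (rad / 4 * (rad / 4)))).
    + apply Rmult_le_compat; [apply Cmod_ge_0| | |].
      * apply Rmult_le_pos; [apply Rmult_le_pos; lra|].
        left. apply Rinv_0_lt_compat. nra.
      * apply HM. rewrite Cmod_polar; lra.
      * apply Rmult_le_compat_l; [apply Rmult_le_pos; lra|].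
        apply Rinv_le_contravar; [nra|]. apply Rmult_le_compat; lra.
    + right. unfold r. field. lra. }
rewrite Cmod_mult, Cmod_R, Rabs_pos_eq in B by lra.
apply (Rmult_le_reg_l (2 * PI)); [lra|].
eapply Rle_trans; [exact B|]. right. field. lra.
Qed.

Lemma is_series_C_iff (a : nat -> C) (l : C) :
  @is_series C_AbsRing C_NormedModule a l <->
  forall eps : R, 0 < eps -> exists N : nat, forall n : nat, (N <= n)%nat ->
    Cmod (sum_n a n - l) < eps.
Proof.
unfold is_series. split.
- intros H e He.
  pose proof (proj1 (filterlim_locally_ball_norm (K := C_AbsRing)
    (U := C_NormedModule) _ _) H (mkposreal e He)) as [N HN].
  exists N. exact HN.
- intros H. apply (proj2 (filterlim_locally_ball_norm (K := C_AbsRing)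
    (U := C_NormedModule) _ _)).
  intros e. destruct (H e (cond_pos e)) as [N HN]. exists N. exact HN.
Qed.

(** * Strict differentiability and power series *)

Lemma cont_pow {U : UniformSpace} (F : U -> C) (x : U) (n : nat) :
  cont F x -> cont (fun u => F u ^ n)%C x.
Proof.
intros HF. induction n as [|n IH]; [apply (cont_const 1%C)|].
now apply (cont_mult F (fun u => F u ^ n)%C).
Qed.

Lemma is_pseries_C_iff (a : nat -> C) (z l : C) :
  @is_pseries C_AbsRing C_NormedModule a z l <->
  forall eps : R, 0 < eps -> exists N : nat, forall n : nat, (N <= n)%nat ->
    Cmod (sum_n (fun k => z ^ k * a k)%C n - l) < eps.
Proof. exact (is_series_C_iff (fun k => z ^ k * a k)%C l). Qed.

Lemma sum_n_C_S (b : nat -> C) (n : nat) :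
  sum_n b (S n) = (sum_n b n + b (S n))%C.
Proof. exact (sum_Sn b n). Qed.

Lemma half_pow_lim (K eps : R) : 0 < eps ->
  exists N : nat, forall n : nat, (N <= n)%nat -> K * (1 / 2) ^ n < eps.
Proof.
intros He.
assert (Hq : Rabs (1 / 2) < 1) by (rewrite Rabs_pos_eq; lra).
pose proof (Rabs_pos K) as HK.
destruct (pow_lt_1_zero _ Hq (eps / (1 + Rabs K))) as [N HN];
  [apply Rdiv_lt_0_compat; lra|].
exists N. intros n Hn. specialize (HN n Hn).
pose proof (pow_lt (1 / 2) n ltac:(lra)) as Hp.
rewrite Rabs_pos_eq in HN by lra.
apply (Rmult_lt_compat_l (1 + Rabs K)) in HN; [|lra].
replace ((1 + Rabs K) * (eps / (1 + Rabs K))) with eps in HN by (field; lra).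
pose proof (Rle_abs K). nra.
Qed.

(** The kernel is expanded as a finite geometric sum with exact remainder, so that only finite sums
    are integrated; the remainder decays because [|z / polar r th| <= 1 / 2]. *)
Lemma holomorphic_pseries_0 (f : C -> C) (rad M : R) :
  0 < rad ->
  (forall w, Cmod w < rad -> exists d, strict_at f w d) ->
  (forall w, Cmod w < rad -> Cmod (f w) <= M) ->
  exists a : nat -> C, forall z, Cmod z < rad / 4 ->
    @is_pseries C_AbsRing C_NormedModule a z (f z).
Proof.
intros HR Hf HM. pose proof PI_RGT_0 as HPI.
set (r := rad / 2). assert (Hr : 0 < r < rad) by (unfold r; lra).
assert (HPI0 : RtoC (2 * PI) <> 0%C)
  by (intros E; apply (f_equal fst) in E; simpl in E; lra).
assert (Hcf : forall th, cont (fun t => f (polar r t)) th)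
  by (intros th; eapply cont_circle; eauto).
assert (Hci : forall th, cont (fun t => / polar r t)%C th)
  by (intros th; apply cont_inv_comp; [apply polar_neq_0; lra|apply cont_polar]).
exists (fun n => CInt (fun th => f (polar r th) * (/ polar r th) ^ n)%C
                 / RtoC (2 * PI))%C.
intros z Hz. pose proof (Cmod_ge_0 z) as Hz0. apply is_pseries_C_iff.
assert (Hzr : Cmod z < r) by (unfold r; lra).
set (b := fun k : nat => (z ^ k * (CInt (fun th => f (polar r th) * (/ polar r th) ^ k)
                 / RtoC (2 * PI)))%C).
(* The integrand of the geometric tail from order [n] on: splitting off one term of the kernel turns
   [rem n] into [rem (S n)]. *)
set (rem := fun n th => (f (polar r th) *
  ((z * / polar r th) ^ n * (polar r th / (polar r th - z))))%C).
assert (Hcq : forall n th, cont (fun t => (z * / polar r t) ^ n)%C th)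
  by (intros n th; apply cont_pow, cont_mult; auto using cont_const).
assert (Hcrem : forall n th, cont (rem n) th).
{ intros n th. apply cont_mult; [apply Hcf|]. apply cont_mult; [apply Hcq|].
  now apply cont_kernel. }
assert (Hstep : forall n, CInt (rem n) = (RtoC (2 * PI) * b n + CInt (rem (S n)))%C).
{ intros n. unfold b.
  replace (RtoC (2 * PI) * (z ^ n *
     (CInt (fun th => f (polar r th) * (/ polar r th) ^ n) / RtoC (2 * PI))))%C
    with (z ^ n * CInt (fun th => f (polar r th) * (/ polar r th) ^ n))%C
    by (field; exact HPI0).
  rewrite <- CInt_scal, <- CInt_plus; auto.
  - apply CInt_ext. intros th. unfold rem. rewrite Cpow_succ, Cpow_mult_l.
    field. split; [now apply polar_sub_neq_0|apply polar_neq_0; lra].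
  - intros th. apply cont_mult; [apply cont_const|].
    apply cont_mult; [apply Hcf|now apply cont_pow].
  - intros th. apply cont_mult; [apply Hcf|now apply cont_pow]. }
assert (Hrem0 : CInt (rem 0%nat) = (RtoC (2 * PI) * f z)%C).
{ rewrite <- (Cauchy_formula f rad r z) by (auto; lra).
  apply CInt_ext. intros th. unfold rem. simpl. ring. }
assert (Hsum : forall n, (RtoC (2 * PI) * (f z - sum_n b n))%C = CInt (rem (S n))).
{ induction n as [|n IH].
  - rewrite sum_O.
    transitivity (CInt (rem 0%nat) - RtoC (2 * PI) * b 0%nat)%C;
      [rewrite Hrem0; ring|rewrite (Hstep 0%nat); ring].
  - rewrite sum_n_C_S.
    transitivity (CInt (rem (S n)) - RtoC (2 * PI) * b (S n))%C;
      [rewrite <- IH; ring|rewrite (Hstep (S n)); ring]. }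
assert (HM0 : 0 <= M).
{ eapply Rle_trans; [apply Cmod_ge_0|apply (HM z)]. lra. }
assert (Hb : forall n, Cmod (sum_n b n - f z) <= 4 * M * (1 / 2) ^ n).
{ intros n. apply (Rmult_le_reg_l (2 * PI)); [lra|].
  replace (2 * PI * Cmod (sum_n b n - f z)) with (Cmod (CInt (rem (S n)))).
  2:{ rewrite <- Hsum, Cmod_mult, Cmod_R, Rabs_pos_eq by lra.
      f_equal. apply Cmod_sub_sym. }
  replace (2 * PI * (4 * M * (1 / 2) ^ n))
    with (4 * PI * (M * ((1 / 2) ^ S n * 4))) by (simpl; field).
  apply CInt_bound; [apply Hcrem|].
  intros th. unfold rem. rewrite !Cmod_mult, Cmod_pow, Cmod_mult.
  rewrite Cmod_inv, Cmod_div by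
    (try apply polar_sub_neq_0; try apply polar_neq_0; lra).
  rewrite Cmod_polar by lra.
  pose proof (Cmod_reverse_triangle (polar r th) z) as A.
  rewrite Cmod_polar in A by lra.
  assert (Hq : 0 <= Cmod z * / r <= 1 / 2).
  { split; [apply Rmult_le_pos; [lra|left; apply Rinv_0_lt_compat; lra]|].
    apply (Rmult_le_reg_r r); [lra|]. rewrite Rmult_assoc, Rinv_l by lra.
    unfold r. lra. }
  apply Rmult_le_compat; [apply Cmod_ge_0| | |].
  - apply Rmult_le_pos; [apply pow_le; lra|].
    apply Rmult_le_pos; [lra|]. left. apply Rinv_0_lt_compat. lra.
  - apply HM. rewrite Cmod_polar; lra.
  - apply Rmult_le_compat; [apply pow_le; lra| |apply pow_incr; lra|].
    + apply Rmult_le_pos; [lra|]. left. apply Rinv_0_lt_compat. lra.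
    + apply (Rmult_le_reg_r (Cmod (polar r th - z))); [lra|].
      unfold Rdiv. rewrite Rmult_assoc, Rinv_l by lra. unfold r in *. lra. }
intros e He. destruct (half_pow_lim (4 * M) e He) as [N HN].
exists N. intros n Hn. fold b. eapply Rle_lt_trans; [apply Hb|]. now apply HN.
Qed.

Lemma strict_at_translate (f : C -> C) (b z0 d : C) :
  strict_at f (b + z0)%C d -> strict_at (fun z => f (b + z)%C) z0 d.
Proof.
intros H e He. destruct (strict_at_affine f z0 d b 1%C 0%C 0%C H e He) as [r [Hr H1]].
exists r. split; [exact Hr|]. intros z w Hz Hw. specialize (H1 z w Hz Hw).
replace (1 * f (b + z) + 0 * z + 0 - (1 * f (b + w) + 0 * w + 0)
  - (1 * d + 0) * (z - w))%C
  with (f (b + z) - f (b + w) - d * (z - w))%C in H1 by ring.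
exact H1.
Qed.

Theorem analytic_on_strict (D : C -> Prop) (f : C -> C) :
  (forall z, D z -> locally z D) ->
  (forall z, D z -> exists d, strict_at f z d) -> analytic_on D f.
Proof.
intros HD Hf z0 Hz0.
destruct (Hf z0 Hz0) as [d0 Hd0]. apply strict_at_cont in Hd0.
(* Continuity at [z0] supplies the bound [|f| <= |f z0| + 1] on a disc, as the expansion
   requires. *)
destruct (proj1 (locally_Cmod _ _) (filter_and (F := locally z0) _ _ (HD z0 Hz0)
  (Hd0 1 Rlt_0_1))) as [r [Hr H]].
assert (Hball : forall w, Cmod w < r -> Cmod (z0 + w - z0) < r)
  by (intros w Hw; now replace (z0 + w - z0)%C with w by ring).
destruct (holomorphic_pseries_0 (fun w => f (z0 + w)%C) r (Cmod (f z0) + 1) Hr)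
  as [a Ha].
- intros w Hw. destruct (H _ (Hball w Hw)) as [H1 _].
  destruct (Hf _ H1) as [d Hd]. exists d. now apply strict_at_translate.
- intros w Hw. destruct (H _ (Hball w Hw)) as [_ H2].
  pose proof (Cmod_reverse_triangle (f (z0 + w)%C) (f z0)). lra.
- exists a. apply locally_Cmod. exists (r / 4). split; [lra|]. intros z Hz.
  specialize (Ha _ Hz). cbv beta in Ha.
  replace (z0 + (z - z0))%C with z in Ha by ring. exact Ha.
Qed.

(** The sharp factor is [(n + 1) rho^n]; absorbing [n + 1] into [2^n] keeps the later majorant
    geometric. *)
Lemma Cmod_pow_sub_le (z w : C) (rho : R) (n : nat) :
  Cmod z <= rho -> Cmod w <= rho ->
  Cmod (z ^ S n - w ^ S n) <= (2 * rho) ^ n * Cmod (z - w).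
Proof.
intros Hz Hw. pose proof (Cmod_ge_0 z) as Hz0.
pose proof (Cmod_ge_0 (z - w)) as Hzw.
induction n as [|n IH].
- simpl. rewrite !Cmult_1_r. lra.
- replace (z ^ S (S n) - w ^ S (S n))%C
    with (z * (z ^ S n - w ^ S n) + (z - w) * w ^ S n)%C
    by (rewrite (Cpow_succ z (S n)), (Cpow_succ w (S n)); ring).
  eapply Rle_trans; [apply Cmod_triangle|]. rewrite !Cmod_mult, Cmod_pow.
  assert (H1 : Cmod w ^ S n <= rho * (2 * rho) ^ n).
  { apply Rle_trans with (rho ^ S n).
    - apply pow_incr. split; [apply Cmod_ge_0|exact Hw].
    - simpl. apply Rmult_le_compat_l; [lra|]. apply pow_incr. lra. }
  assert (H2 : Cmod z * Cmod (z ^ S n - w ^ S n)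
    <= rho * ((2 * rho) ^ n * Cmod (z - w))).
  { apply Rmult_le_compat; auto using Cmod_ge_0. }
  change ((2 * rho) ^ S n) with (2 * rho * (2 * rho) ^ n). nra.
Qed.

(** The terms are differences of consecutive partial sums, which are bounded since they converge. *)
Lemma pseries_coeff_bound (a : nat -> C) (x : R) (l : C) :
  @is_pseries C_AbsRing C_NormedModule a (RtoC x) l ->
  exists K, forall n, Cmod (a n) * Rabs x ^ n <= K.
Proof.
intros H.
set (b := fun n => (RtoC x ^ n * a n)%C).
destruct (filterlim_bounded (K := C_AbsRing) (V := C_NormedModule) (sum_n b)
  (ex_intro _ l H)) as [K HK].
change (forall n, Cmod (sum_n b n) <= K) in HK.
exists (2 * K). intros n.
replace (Cmod (a n) * Rabs x ^ n) with (Cmod (b n))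
  by (unfold b; rewrite Cmod_mult, Cmod_pow, Cmod_R; ring).
pose proof (HK n) as Hn. destruct n as [|n].
- rewrite sum_O in Hn. pose proof (Cmod_ge_0 (b 0%nat)). lra.
- specialize (HK n).
  replace (b (S n)) with (sum_n b (S n) + - sum_n b n)%C
    by (rewrite sum_n_C_S; ring).
  pose proof (Cmod_triangle (sum_n b (S n)) (- sum_n b n)) as T.
  rewrite Cmod_opp in T. lra.
Qed.

(** In [f z - f w - a 1 * (z - w)] the constant and linear terms cancel. Each term of order [k >= 2]
    is at most [K / x0 * q^(k-1) * |z - w|], by the coefficient bound and [Cmod_pow_sub_le]. *)
Theorem pseries_strict_at (f : C -> C) (a : nat -> C) (z0 : C) :
  locally z0 (fun z => @is_pseries C_AbsRing C_NormedModule a (z - z0)%C (f z)) ->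
  strict_at f z0 (a 1%nat).
Proof.
intros H. apply locally_Cmod in H. destruct H as [r [Hr H]].
set (x0 := r / 2). assert (Hx0 : 0 < x0 < r) by (unfold x0; lra).
destruct (pseries_coeff_bound a x0 (f (z0 + RtoC x0)%C)) as [K0 HK0].
{ specialize (H (z0 + RtoC x0)%C).
  replace (z0 + RtoC x0 - z0)%C with (RtoC x0) in H by ring.
  apply H. rewrite Cmod_R, Rabs_pos_eq; lra. }
rewrite Rabs_pos_eq in HK0 by lra.
set (K := Rmax K0 1).
assert (HK1 : 1 <= K) by apply Rmax_r.
assert (HK : forall n, Cmod (a n) * x0 ^ n <= K)
  by (intros n; eapply Rle_trans; [apply HK0|apply Rmax_l]).
intros e He.
(* [q <= 1 / 2] bounds the sum of [q^j] over [j >= 1] by [2 q]; the other entry makes [K / x0 * 2 q]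
   at most [e]. *)
set (q := Rmin (1 / 2) (e * x0 / (2 * K))).
assert (Hex : 0 < e * x0) by (apply Rmult_lt_0_compat; lra).
assert (Hq : 0 < q) by (apply Rmin_pos; [lra|apply Rdiv_lt_0_compat; lra]).
assert (Hq1 : q <= 1 / 2) by apply Rmin_l.
assert (Hq2 : K / x0 * (2 * q) <= e).
{ apply Rle_trans with (K / x0 * (2 * (e * x0 / (2 * K)))).
  - apply Rmult_le_compat_l; [left; apply Rdiv_lt_0_compat; lra|].
    apply Rmult_le_compat_l; [lra|apply Rmin_r].
  - right. field. lra. }
exists (x0 * q / 2). split; [nra|]. intros z w Hz Hw.
assert (Hrad : x0 * q / 2 <= x0) by nra.
pose proof (H z ltac:(lra)) as Sz. pose proof (H w ltac:(lra)) as Sw.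
rewrite is_pseries_C_iff in Sz, Sw.
set (u := (z - z0)%C) in *. set (v := (w - z0)%C) in *.
assert (Euv : (z - w)%C = (u - v)%C) by (unfold u, v; ring).
rewrite Euv. pose proof (Cmod_ge_0 (u - v)) as Huv.
set (bu := fun k => (u ^ k * a k)%C) in *. set (bv := fun k => (v ^ k * a k)%C) in *.
assert (HKx : 0 < K / x0) by (apply Rdiv_lt_0_compat; lra).
(* [2 q - 2 q^(N+1)] dominates [q + ... + q^N] and makes the induction close: adding [q^(N+1)] is
   paid for by [2 q^(N+2) <= q^(N+1)]. *)
assert (Hpart : forall N, Cmod (sum_n bu (S N) - sum_n bv (S N) - a 1%nat * (u - v))
   <= K / x0 * (2 * q - 2 * q ^ S N) * Cmod (u - v)).
{ induction N as [|N IH].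
  - rewrite !sum_n_C_S, !sum_O. unfold bu, bv.
    replace (u ^ 0 * a 0%nat + u ^ 1 * a 1%nat
      - (v ^ 0 * a 0%nat + v ^ 1 * a 1%nat) - a 1%nat * (u - v))%C
      with (RtoC 0) by (simpl; ring).
    rewrite Cmod_0. simpl. right. ring.
  - rewrite (sum_n_C_S bu (S N)), (sum_n_C_S bv (S N)).
    replace (sum_n bu (S N) + bu (S (S N)) - (sum_n bv (S N) + bv (S (S N)))
       - a 1%nat * (u - v))%C
      with ((sum_n bu (S N) - sum_n bv (S N) - a 1%nat * (u - v))
        + a (S (S N)) * (u ^ S (S N) - v ^ S (S N)))%C by (unfold bu, bv; ring).
    eapply Rle_trans; [apply Cmod_triangle|]. rewrite Cmod_mult.
    assert (T : Cmod (a (S (S N))) * Cmod (u ^ S (S N) - v ^ S (S N))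
       <= K / x0 * q ^ S N * Cmod (u - v)).
    { apply Rle_trans with (Cmod (a (S (S N))) *
        ((2 * (x0 * q / 2)) ^ S N * Cmod (u - v))).
      - apply Rmult_le_compat_l; [apply Cmod_ge_0|].
        apply Cmod_pow_sub_le; lra.
      - replace (2 * (x0 * q / 2)) with (x0 * q) by field.
        rewrite Rpow_mult_distr, <- !Rmult_assoc.
        apply Rmult_le_compat_r; [lra|].
        apply Rmult_le_compat_r; [apply pow_le; lra|].
        apply (Rmult_le_reg_r x0); [lra|].
        replace (K / x0 * x0) with K by (field; lra).
        eapply Rle_trans; [|apply (HK (S (S N)))].
        right. simpl. ring. }
    assert (P : q ^ S (S N) <= q ^ S N * (1 / 2)).
    { rewrite (Rmult_comm _ (1 / 2)). simpl (q ^ S (S N)).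
      apply Rmult_le_compat_r; [change (0 <= q ^ S N); apply pow_le; lra|lra]. }
    assert (0 <= K / x0 * Cmod (u - v)) by (apply Rmult_le_pos; lra).
    assert (K / x0 * Cmod (u - v) * (2 * q ^ S (S N))
      <= K / x0 * Cmod (u - v) * q ^ S N)
      by (apply Rmult_le_compat_l; lra).
    lra. }
apply le_epsilon. intros d Hd.
destruct (Sz (d / 2) ltac:(lra)) as [N1 HN1].
destruct (Sw (d / 2) ltac:(lra)) as [N2 HN2].
set (N := (N1 + N2)%nat).
specialize (HN1 (S N) ltac:(unfold N; lia)).
specialize (HN2 (S N) ltac:(unfold N; lia)).
specialize (Hpart N).
replace (f z - f w - a 1%nat * (u - v))%C
  with ((sum_n bu (S N) - sum_n bv (S N) - a 1%nat * (u - v))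
    + (- (sum_n bu (S N) - f z) + (sum_n bv (S N) - f w)))%C by ring.
eapply Rle_trans; [apply Cmod_triangle|].
pose proof (Cmod_triangle (- (sum_n bu (S N) - f z)) (sum_n bv (S N) - f w)) as T.
rewrite Cmod_opp in T.
assert (K / x0 * (2 * q - 2 * q ^ S N) * Cmod (u - v) <= e * Cmod (u - v)).
{ apply Rmult_le_compat_r; [lra|]. eapply Rle_trans; [|exact Hq2].
  apply Rmult_le_compat_l; [lra|].
  pose proof (pow_le q (S N) ltac:(lra)). lra. }
lra.
Qed.

(** An initial displacement of [r / 2] and the factor 1/2 keep the closed disc invariant. The limit
    of the iterates is [z0] plus the sum of their increments, an absolutely convergent series. *)
Lemma contraction_fixed_point (T : C -> C) (z0 : C) (r : R) :
  (forall z w, Cmod (z - z0) <= r -> Cmod (w - z0) <= r ->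
     Cmod (T z - T w) <= / 2 * Cmod (z - w)) ->
  Cmod (T z0 - z0) <= r / 2 ->
  exists z : C, Cmod (z - z0) <= r /\ T z = z.
Proof.
intros HT H0.
assert (HR : 0 <= r) by (pose proof (Cmod_ge_0 (T z0 - z0)); lra).
assert (Hzz : Cmod (z0 - z0) <= r)
  by (replace (z0 - z0)%C with (RtoC 0) by ring; now rewrite Cmod_0).
set (u := fix u n := match n with O => z0 | S n => T (u n) end).
assert (Hself : forall z, Cmod (z - z0) <= r -> Cmod (T z - z0) <= r).
{ intros z Hz. specialize (HT z z0 Hz Hzz).
  pose proof (Cmod_sub_triangle (T z0) (T z) z0). lra. }
assert (Hu : forall n, Cmod (u n - z0) <= r).
{ induction n as [|n IH]; [exact Hzz|]. now apply Hself. }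
assert (Hd : forall n, Cmod (u (S n) - u n) <= r / 2 * (1 / 2) ^ n).
{ induction n as [|n IH]; [simpl; lra|].
  eapply Rle_trans; [apply (HT (u (S n)) (u n)); apply Hu|].
  simpl (_ ^ S n). lra. }
assert (Hex : ex_series (V := C_CompleteNormedModule) (fun n => (u (S n) - u n)%C)).
{ apply ex_series_le with (b := fun n => r / 2 * (1 / 2) ^ n); [exact Hd|].
  apply (ex_series_scal (K := R_AbsRing) (V := R_NormedModule) (r / 2)).
  apply ex_series_geom. rewrite Rabs_pos_eq; lra. }
destruct Hex as [l Hl].
pose proof (proj1 (is_series_C_iff _ _) Hl) as Hlim.
assert (Hsum : forall n, @eq C (sum_n (fun n => (u (S n) - u n)%C) n) (u (S n) - z0)%C).
{ induction n as [|n IH]; [now rewrite sum_O|].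
  rewrite sum_n_C_S, IH. ring. }
assert (Hlim' : forall e, 0 < e -> exists n, Cmod (u n - (z0 + l)) < e
    /\ Cmod (u (S n) - (z0 + l)) < e).
{ intros e He. destruct (Hlim e He) as [N HN]. exists (S N). split.
  - specialize (HN N ltac:(lia)). rewrite Hsum in HN.
    replace (u (S N) - (z0 + l))%C with (u (S N) - z0 - l)%C by ring. exact HN.
  - specialize (HN (S N) ltac:(lia)). rewrite Hsum in HN.
    replace (u (S (S N)) - (z0 + l))%C with (u (S (S N)) - z0 - l)%C by ring.
    exact HN. }
assert (Hin : Cmod (z0 + l - z0) <= r).
{ apply le_epsilon. intros e He. destruct (Hlim' e He) as [n [Hn _]].
  rewrite Cmod_sub_sym in Hn. specialize (Hu n).
  pose proof (Cmod_sub_triangle (u n) (z0 + l) z0). lra. }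
exists (z0 + l)%C. split; [exact Hin|].
assert (E : Cmod (T (z0 + l)%C - (z0 + l)) = 0).
{ apply Rle_antisym; [|apply Cmod_ge_0]. apply le_epsilon. intros e He.
  destruct (Hlim' (e / 2) ltac:(lra)) as [n [H1 H2]].
  pose proof (HT _ _ Hin (Hu n)) as H3.
  rewrite (Cmod_sub_sym (z0 + l) (u n)) in H3.
  pose proof (Cmod_sub_triangle (u (S n)) (T (z0 + l)%C) (z0 + l)) as H4.
  change (T (u n)) with (u (S n)) in H3. lra. }
apply Cmod_eq_0 in E.
replace (T (z0 + l)%C) with ((T (Cplus z0 l) - (z0 + l)) + (z0 + l))%C by ring.
rewrite E. ring.
Qed.

(** * Nearly linear functions, inverse functions and sectors *)

(** [Cauchy_lipschitz], applied to the remainder recentred at [a], gives the constant [16 e / r];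
    the condition [32 e <= |m| r] is exactly what brings it down to [|m| / 2]. *)
Lemma near_linear_remainder_lipschitz (f : C -> C) (a m : C) (r e : R) :
  0 < r ->
  (forall z, Cmod (z - a) < r -> exists d, strict_at f z d) ->
  (forall z, Cmod (z - a) < r -> Cmod (f z - m * z) <= e) ->
  32 * e <= Cmod m * r ->
  forall z w, Cmod (z - a) <= r / 4 -> Cmod (w - a) <= r / 4 ->
  Cmod ((f z - m * z) - (f w - m * w)) <= Cmod m / 2 * Cmod (z - w).
Proof.
intros Hr Hf He Hem z w Hz Hw.
assert (Hball : forall v, Cmod v < r -> Cmod (a + v - a) < r)
  by (intros v Hv; now replace (a + v - a)%C with v by ring).
pose proof (Cauchy_lipschitz (fun v => 1 * f (a + v) + - m * v + - (m * a))%C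
  r e (z - a) (w - a) Hr) as H.
cbv beta in H.
replace (a + (z - a))%C with z in H by ring.
replace (a + (w - a))%C with w in H by ring.
replace (1 * f z + - m * (z - a) + - (m * a)
  - (1 * f w + - m * (w - a) + - (m * a)))%C
  with ((f z - m * z) - (f w - m * w))%C in H by ring.
replace (z - a - (w - a))%C with (z - w)%C in H by ring.
eapply Rle_trans; [apply H; auto|].
- intros v Hv. destruct (Hf _ (Hball v Hv)) as [d Hd].
  eexists. apply strict_at_affine, Hd.
- intros v Hv. specialize (He _ (Hball v Hv)).
  replace (1 * f (a + v) + - m * v + - (m * a))%C
    with (f (a + v) - m * (a + v))%C by ring. exact He.
- apply Rmult_le_compat_r; [apply Cmod_ge_0|].
  apply (Rmult_le_reg_r r); [exact Hr|].
  replace (16 * e / r * r) with (16 * e) by (field; lra). lra.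
Qed.

Lemma near_linear_expanding (f : C -> C) (a m : C) (r e : R) :
  0 < r ->
  (forall z, Cmod (z - a) < r -> exists d, strict_at f z d) ->
  (forall z, Cmod (z - a) < r -> Cmod (f z - m * z) <= e) ->
  32 * e <= Cmod m * r ->
  forall z w, Cmod (z - a) <= r / 4 -> Cmod (w - a) <= r / 4 ->
  Cmod m / 2 * Cmod (z - w) <= Cmod (f z - f w).
Proof.
intros Hr Hf He Hem z w Hz Hw.
pose proof (near_linear_remainder_lipschitz f a m r e Hr Hf He Hem z w Hz Hw) as H.
pose proof (Cmod_reverse_triangle (m * (z - w))
  (- (f z - m * z - (f w - m * w)))) as H1.
rewrite Cmod_mult, Cmod_opp in H1.
replace (m * (z - w) - - (f z - m * z - (f w - m * w)))%C
  with (f z - f w)%C in H1 by ring.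
lra.
Qed.

(** [f z = y] is the fixed-point equation [z = (y - (f z - m z)) / m]. Started at [a], the
    displacement is at most [r / 16 + r / 32], below the admissible [r / 8]. *)
Lemma near_linear_onto (f : C -> C) (a m : C) (r e : R) :
  0 < r -> m <> 0%C ->
  (forall z, Cmod (z - a) < r -> exists d, strict_at f z d) ->
  (forall z, Cmod (z - a) < r -> Cmod (f z - m * z) <= e) ->
  32 * e <= Cmod m * r ->
  forall y, Cmod (y - m * a) <= Cmod m * r / 16 ->
  exists z : C, Cmod (z - a) <= r / 4 /\ f z = y.
Proof.
intros Hr Hm Hf He Hem y Hy. pose proof (proj1 (Cmod_gt_0 m) Hm) as Hm0.
assert (Haa : Cmod (a - a) < r)
  by (replace (a - a)%C with (RtoC 0) by ring; now rewrite Cmod_0).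
destruct (contraction_fixed_point (fun z => (y - (f z - m * z)) / m)%C a (r / 4))
  as [z [Hz HT]].
- intros z w Hz Hw.
  pose proof (near_linear_remainder_lipschitz f a m r e Hr Hf He Hem w z Hw Hz) as H.
  replace ((y - (f z - m * z)) / m - (y - (f w - m * w)) / m)%C
    with ((f w - m * w - (f z - m * z)) / m)%C by (field; exact Hm).
  rewrite Cmod_div by exact Hm.
  apply (Rmult_le_reg_r (Cmod m)); [exact Hm0|].
  unfold Rdiv. rewrite Rmult_assoc, Rinv_l, Rmult_1_r by lra.
  rewrite (Cmod_sub_sym z w). lra.
- replace ((y - (f a - m * a)) / m - a)%C
    with (((y - m * a) + - (f a - m * a)) / m)%C by (field; exact Hm).
  rewrite Cmod_div by exact Hm.
  apply (Rmult_le_reg_r (Cmod m)); [exact Hm0|].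
  unfold Rdiv at 1. rewrite Rmult_assoc, Rinv_l, Rmult_1_r by lra.
  eapply Rle_trans; [apply Cmod_triangle|]. rewrite Cmod_opp.
  specialize (He a Haa). nra.
- exists z. split; [exact Hz|].
  replace (f z) with (m * ((f z - m * z) / m + z))%C by (field; exact Hm).
  rewrite <- HT at 3. field. exact Hm.
Qed.

(** The strict estimate of [f] is read at the pair [(g y, g y')] and divided by [d]. The expansion
    bound makes [g] continuous at [y0] and converts [|g y - g y'|] into [|y - y'| / k], whence the
    tolerance [e * |d| * k]. *)
Lemma strict_at_inverse (f g : C -> C) (y0 d : C) (k : R) :
  0 < k -> d <> 0%C -> strict_at f (g y0) d ->
  locally y0 (fun y => f (g y) = y) ->
  (exists delta, 0 < delta /\ forall y y',
     Cmod (y - y0) < delta -> Cmod (y' - y0) < delta ->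
     k * Cmod (g y - g y') <= Cmod (y - y')) ->
  strict_at g y0 (/ d)%C.
Proof.
intros Hk Hd Hf Hfg [r1 [Hr1 H1]] e He.
apply locally_Cmod in Hfg. destruct Hfg as [r2 [Hr2 H2]].
pose proof (proj1 (Cmod_gt_0 d) Hd) as Hd0.
destruct (Hf (e * Cmod d * k)) as [r3 [Hr3 H3]];
  [repeat apply Rmult_lt_0_compat; lra|].
exists (Rmin r1 (Rmin r2 (k * r3))).
assert (Hkr : 0 < k * r3) by (apply Rmult_lt_0_compat; lra).
split; [repeat apply Rmin_pos; lra|].
intros y y' Hy Hy'.
assert (Hsplit : forall v, Cmod (v - y0) < Rmin r1 (Rmin r2 (k * r3)) ->
   Cmod (v - y0) < r1 /\ Cmod (v - y0) < r2 /\ Cmod (v - y0) < k * r3).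
{ intros v Hv. pose proof (Rmin_l r1 (Rmin r2 (k * r3))).
  pose proof (Rmin_r r1 (Rmin r2 (k * r3))).
  pose proof (Rmin_l r2 (k * r3)). pose proof (Rmin_r r2 (k * r3)). lra. }
assert (H00 : Cmod (y0 - y0) < r1)
  by (replace (y0 - y0)%C with (RtoC 0) by ring; now rewrite Cmod_0).
assert (Hg : forall v, Cmod (v - y0) < r1 -> Cmod (v - y0) < k * r3 ->
   Cmod (g v - g y0) < r3).
{ intros v Hv Hv'. specialize (H1 v y0 Hv H00).
  apply (Rmult_lt_reg_l k); lra. }
destruct (Hsplit y Hy) as [A1 [A2 A3]]. destruct (Hsplit y' Hy') as [B1 [B2 B3]].
specialize (H3 (g y) (g y') (Hg y A1 A3) (Hg y' B1 B3)).
rewrite (H2 y A2), (H2 y' B2) in H3.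
replace (g y - g y' - / d * (y - y'))%C
  with (- (y - y' - d * (g y - g y')) / d)%C by (field; exact Hd).
rewrite Cmod_div, Cmod_opp by exact Hd.
apply (Rmult_le_reg_r (Cmod d)); [exact Hd0|].
unfold Rdiv. rewrite Rmult_assoc, Rinv_l, Rmult_1_r by lra.
eapply Rle_trans; [exact H3|].
specialize (H1 y y' A1 B1).
assert (0 < e * Cmod d) by (apply Rmult_lt_0_compat; lra). nra.
Qed.

(** With [d = 0], the strict estimate with tolerance [k / 2] would contradict the expansion at any
    nearby point. *)
Lemma strict_at_derivative_neq_0 (f : C -> C) (z0 d : C) (k r : R) :
  0 < k -> 0 < r -> strict_at f z0 d ->
  (forall z, Cmod (z - z0) <= r -> k * Cmod (z - z0) <= Cmod (f z - f z0)) ->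
  d <> 0%C.
Proof.
intros Hk Hr Hf H E. subst d.
destruct (Hf (k / 2) ltac:(lra)) as [r1 [Hr1 H1]].
set (h := Rmin (r1 / 2) r).
assert (Hh : 0 < h) by (apply Rmin_pos; lra).
assert (Hh1 : h <= r1 / 2) by apply Rmin_l.
assert (Hh2 : h <= r) by apply Rmin_r.
set (z := (z0 + RtoC h)%C).
assert (Hz : Cmod (z - z0) = h).
{ replace (z - z0)%C with (RtoC h) by (unfold z; ring).
  rewrite Cmod_R. apply Rabs_pos_eq. lra. }
assert (Hz0 : Cmod (z0 - z0) = 0)
  by (replace (z0 - z0)%C with (RtoC 0) by ring; apply Cmod_0).
specialize (H z ltac:(lra)). specialize (H1 z z0 ltac:(lra) ltac:(lra)).
replace (f z - f z0 - 0 * (z - z0))%C with (f z - f z0)%C in H1 by ring.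
rewrite Hz in H, H1. nra.
Qed.

(** Turns membership into inequalities between [Re] and [Cmod], which are stable under perturbation.
    Conversely, the angle is [acos (Re z / Cmod z)] up to the sign of [Im z]. *)
Lemma sector_iff (rho alpha : R) (z : C) : 0 < alpha <= PI ->
  (sector rho alpha z <-> 0 < Cmod z < rho /\ Cmod z * cos alpha < Re z).
Proof.
intros Ha. split.
- intros [r [th [Hr [Hth Ez]]]]. subst z. rewrite Cmod_polar by lra.
  split; [lra|]. unfold polar; simpl. apply Rmult_lt_compat_l; [lra|].
  replace (cos th) with (cos (Rabs th)).
  + apply cos_decreasing_1; pose proof (Rabs_pos th); lra.
  + unfold Rabs. destruct (Rcase_abs th); auto using cos_neg.
- intros [[Hz Hrho] Hre].
  set (x := Re z / Cmod z).
  assert (Hx : -1 <= x <= 1).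
  { pose proof (re_le_Cmod z) as B. apply Rabs_le_between in B.
    unfold x. split; apply (Rmult_le_reg_r (Cmod z)); try lra;
      unfold Rdiv; rewrite Rmult_assoc, Rinv_l; lra. }
  assert (Hxa : cos alpha < x).
  { apply (Rmult_lt_reg_r (Cmod z)); [lra|]. unfold x, Rdiv.
    rewrite Rmult_assoc, Rinv_l; lra. }
  assert (Ex : Re z = Cmod z * x) by (unfold x; field; lra).
  pose proof (acos_bound x) as Hac. pose proof (cos_acos x Hx) as Hcos.
  assert (Hlt : acos x < alpha).
  { destruct (Rlt_or_le (acos x) alpha) as [H|H]; [exact H|].
    assert (cos (acos x) <= cos alpha) by (apply cos_decr_1; lra). lra. }
  assert (Hs : 0 <= sin (acos x)) by (apply sin_ge_0; lra).
  assert (Him : Im z * Im z = (Cmod z * sin (acos x)) * (Cmod z * sin (acos x))).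
  { pose proof (Cmod2_alt z) as B. pose proof (sin2_cos2 (acos x)) as S.
    unfold Rsqr in S. rewrite Hcos in S. rewrite Ex in B.
    replace (Cmod z * sin (acos x) * (Cmod z * sin (acos x)))
      with (Cmod z * Cmod z * (sin (acos x) * sin (acos x))) by ring.
    replace (sin (acos x) * sin (acos x)) with (1 - x * x) by lra.
    simpl in B. lra. }
  assert (HIm : Im z = Cmod z * sin (acos x) \/ Im z = - (Cmod z * sin (acos x))).
  { assert (P : (Im z - Cmod z * sin (acos x)) * (Im z + Cmod z * sin (acos x)) = 0)
      by lra.
    apply Rmult_integral in P. destruct P; [left|right]; lra. }
  destruct HIm as [E|E].
  + exists (Cmod z), (acos x). split; [lra|]. split.
    * rewrite Rabs_pos_eq; lra.
    * unfold polar. rewrite Hcos, <- E, <- Ex. apply surjective_pairing.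
  + exists (Cmod z), (- acos x). split; [lra|]. split.
    * rewrite Rabs_Ropp, Rabs_pos_eq; lra.
    * unfold polar. rewrite cos_neg, sin_neg, Hcos, Ropp_mult_distr_r_reverse.
      rewrite <- E, <- Ex. apply surjective_pairing.
Qed.

Lemma sector_PI_iff (rho : R) (z : C) :
  sector rho PI z <-> 0 < Cmod z < rho /\ 0 < Re z + Cmod z.
Proof.
pose proof PI_RGT_0. rewrite sector_iff by lra. rewrite cos_PI.
split; intros [H1 H2]; split; lra.
Qed.

Lemma sector_open (rho alpha : R) (z : C) : 0 < alpha <= PI ->
  sector rho alpha z -> locally z (sector rho alpha).
Proof.
intros Ha Hz. apply (sector_iff _ _ _ Ha) in Hz. destruct Hz as [[H1 H2] H3].
apply locally_Cmod.
(* Halved because [Re] and [Cmod * cos alpha] may each move by [d]. *)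
set (d := Rmin (Rmin (Cmod z) (rho - Cmod z)) ((Re z - Cmod z * cos alpha) / 2)).
exists d. split; [repeat apply Rmin_pos; lra|]. intros w Hw.
assert (D1 : d <= Cmod z) by (eapply Rle_trans; [apply Rmin_l|apply Rmin_l]).
assert (D2 : d <= rho - Cmod z) by (eapply Rle_trans; [apply Rmin_l|apply Rmin_r]).
assert (D3 : d <= (Re z - Cmod z * cos alpha) / 2) by apply Rmin_r.
apply (sector_iff _ _ _ Ha).
pose proof (Cmod_reverse_triangle w z) as A.
pose proof (Cmod_reverse_triangle z w) as B. rewrite Cmod_sub_sym in B.
pose proof (re_le_Cmod (w - z)) as E. apply Rabs_le_between in E.
change (Re (w - z)) with (Re w - Re z) in E.
pose proof (COS_bound alpha) as Hc.
split; [lra|]. nra.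
Qed.

(** * Asymptotics of the logarithm and of [Psi] *)

Lemma ln_le_sub_1 (x : R) : 0 < x -> ln x <= x - 1.
Proof.
intros Hx. pose proof (exp_ineq1_le (ln x)) as H. rewrite exp_ln in H by exact Hx.
lra.
Qed.

Lemma ln_dist_le_1 (a b : R) : 0 < a -> a / 2 <= b <= 2 * a ->
  Rabs (ln b - ln a) <= 1.
Proof.
intros Ha [H1 H2].
assert (Hb : 0 < b) by lra.
assert (L2 : ln 2 <= 1) by (pose proof (ln_le_sub_1 2); lra).
assert (A : ln b <= ln 2 + ln a) by (rewrite <- ln_mult by lra; apply ln_le; lra).
assert (B : ln a <= ln 2 + ln b) by (rewrite <- ln_mult by lra; apply ln_le; lra).
apply Rabs_le. lra.
Qed.

(** Valid on the slit as well, since the imaginary part is twice an arctangent; this matters for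
    [Cln (Psi z)], where the argument of [Psi z] is unknown. *)
Lemma Cln_Im_bound (z : C) : Rabs (Im (Cln z)) <= PI.
Proof.
unfold Cln; simpl. pose proof (atan_bound (snd z / (Cmod z + fst z))).
apply Rabs_le. unfold Re, Im in *. lra.
Qed.

Lemma Cmod_Cln_ge (z : C) : - ln (Cmod z) <= Cmod (Cln z).
Proof.
eapply Rle_trans; [|apply re_le_Cmod]. simpl.
rewrite <- Rabs_Ropp. apply Rle_abs.
Qed.

Lemma ln_small (B : R) : exists rho, 0 < rho /\
  forall x, 0 < x < rho -> B <= - ln x.
Proof.
exists (exp (- B)). split; [apply exp_pos|]. intros x [Hx Hx'].
apply ln_increasing in Hx'; [|exact Hx]. rewrite ln_exp in Hx'. lra.
Qed.

(** The real parts differ by at most [K + ln X] with [X = |Cln y|], the imaginary parts by at most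
    [2 PI], and [ln X <= 2 sqrt X]. It is used with [z] close to [approx_inv c y], and with the two
    roles exchanged when [y = Psi z]. *)
Lemma Cln_close (K eps : R) : 0 < eps -> exists rho, 0 < rho /\
  forall y z : C, 0 < Cmod y < rho ->
  Rabs (ln (Cmod z) - ln (Cmod y)) <= K + Rabs (ln (Cmod (Cln y))) ->
  Cmod (Cln z - Cln y) <= eps * Cmod (Cln y).
Proof.
intros He. pose proof PI_RGT_0 as HPI.
set (K' := Rabs K + 2 * PI). pose proof (Rabs_pos K) as HKp.
(* Once [t = sqrt X >= N], both [2 t] and [K'] are at most [eps / 2 * t^2]. *)
set (N := 1 + 4 / eps + 2 * K' / eps).
assert (H4 : 0 < 4 / eps) by (apply Rdiv_lt_0_compat; lra).
assert (HK : 0 < 2 * K' / eps) by (apply Rdiv_lt_0_compat; unfold K'; lra).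
destruct (ln_small (N * N)) as [rho [Hrho Hln]].
exists rho. split; [exact Hrho|]. intros y z Hy Hyz.
specialize (Hln _ Hy). pose proof (Cmod_Cln_ge y) as HX.
set (X := Cmod (Cln y)) in *.
assert (HN1 : 1 <= N) by (unfold N; lra).
assert (HNX : N * N <= X) by lra.
assert (HX1 : 1 <= X) by nra.
set (t := sqrt X).
assert (Ett : t * t = X) by (apply sqrt_sqrt; lra).
assert (HNt : N <= t)
  by (rewrite <- (sqrt_square N) by lra; apply sqrt_le_1_alt; exact HNX).
assert (HlnX : ln X <= 2 * t).
{ rewrite <- Ett, ln_mult by lra. pose proof (ln_le_sub_1 t ltac:(lra)). lra. }
assert (HlnX0 : 0 <= ln X) by (rewrite <- ln_1; apply ln_le; lra).
rewrite (Rabs_pos_eq (ln X)) in Hyz by exact HlnX0.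
assert (D : Cmod (Cln z - Cln y) <= K' + 2 * t).
{ eapply Rle_trans; [apply Cmod_le_re_im|].
  change (Re (Cln z - Cln y)) with (ln (Cmod z) - ln (Cmod y)).
  change (Im (Cln z - Cln y)) with (Im (Cln z) - Im (Cln y)).
  pose proof (Cln_Im_bound z). pose proof (Cln_Im_bound y).
  pose proof (Rabs_triang (Im (Cln z)) (- Im (Cln y))) as T.
  rewrite Rabs_Ropp in T. unfold Rminus at 2.
  pose proof (Rle_abs K). unfold K'. lra. }
eapply Rle_trans; [exact D|]. rewrite <- Ett.
assert (E1 : 4 <= eps * t).
{ apply Rle_trans with (eps * (4 / eps)); [right; field; lra|].
  apply Rmult_le_compat_l; unfold N in HNt; lra. }
assert (E2 : 2 * K' <= eps * t).
{ apply Rle_trans with (eps * (2 * K' / eps)); [right; field; lra|].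
  apply Rmult_le_compat_l; unfold N in HNt; lra. }
nra.
Qed.

Lemma equiv_at_0_iff (D : C -> Prop) (f g : C -> C) :
  equiv_at_0 D f g <->
  forall eps : R, 0 < eps -> exists delta, 0 < delta /\
    forall z, D z -> Cmod z < delta -> Cmod (g z - f z) <= eps * Cmod (g z).
Proof.
unfold equiv_at_0, is_equiv, is_domin, within. split.
- intros H e He. specialize (H (mkposreal e He)). cbv beta in H.
  apply locally_Cmod in H. destruct H as [d [Hd H]].
  exists d. split; [exact Hd|]. intros z Hz Hzd.
  apply H; [|exact Hz]. now replace (z - 0)%C with z by ring.
- intros H e. destruct (H e (cond_pos e)) as [d [Hd H']].
  apply locally_Cmod. exists d. split; [exact Hd|]. intros z Hz HDz.
  apply H'; [exact HDz|]. now replace (z - 0)%C with z in Hz by ring.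
Qed.

Definition approx_inv (c : R) (y : C) : C := (- (y / (RtoC c * Cln y)))%C.

Lemma RtoC_neq_0 (x : R) : x <> 0 -> RtoC x <> 0%C.
Proof. intros Hx E. apply Hx. exact (f_equal fst E). Qed.

Section Asymptotics.

Context (Psi : C -> C) (s c : R) (Hc : 0 < c)
  (HPsi : equiv_at_0 (sector s PI) Psi
     (fun z : C => (- (RtoC c * z * Cln z))%C)).

(** Solved for [|y|], so that taking logarithms yields the hypothesis of [Cln_close]. *)
Lemma Cmod_approx_inv (y : C) : 0 < Cmod (Cln y) ->
  Cmod y = c * Cmod (approx_inv c y) * Cmod (Cln y).
Proof.
intros HL. unfold approx_inv.
assert (NL : (RtoC c * Cln y)%C <> 0%C)
  by (apply Cmult_neq_0; [apply RtoC_neq_0; lra|now apply Cmod_neq_0]).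
rewrite Cmod_opp, Cmod_div, Cmod_mult, Cmod_R, Rabs_pos_eq by (auto; lra).
field. lra.
Qed.

Lemma approx_inv_slope (y : C) : y <> 0%C -> 0 < Cmod (Cln y) ->
  (y / approx_inv c y = - (RtoC c * Cln y))%C.
Proof.
intros Hy HL. unfold approx_inv. field.
repeat split; auto using Cmod_neq_0. apply RtoC_neq_0. lra.
Qed.

Lemma approx_inv_small (eps : R) : 0 < eps -> exists rho, 0 < rho /\
  forall y : C, 0 < Cmod y < rho ->
  1 <= Cmod (Cln y) /\ 0 < Cmod (approx_inv c y) < eps.
Proof.
intros He. destruct (ln_small 1) as [r1 [Hr1 H1]].
exists (Rmin r1 (c * eps)).
assert (Hce : 0 < c * eps) by (apply Rmult_lt_0_compat; lra).
split; [now apply Rmin_pos|]. intros y [Hy Hy'].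
assert (Y1 : Cmod y < r1) by (eapply Rlt_le_trans; [exact Hy'|apply Rmin_l]).
assert (Y2 : Cmod y < c * eps) by (eapply Rlt_le_trans; [exact Hy'|apply Rmin_r]).
specialize (H1 _ (conj Hy Y1)). pose proof (Cmod_Cln_ge y) as HL.
assert (HL1 : 1 <= Cmod (Cln y)) by lra. split; [exact HL1|].
pose proof (Cmod_approx_inv y ltac:(lra)) as E.
pose proof (Cmod_ge_0 (approx_inv c y)) as H0.
split.
- destruct H0 as [H0|H0]; [exact H0|]. rewrite <- H0 in E. lra.
- apply (Rmult_lt_reg_l c); [exact Hc|].
  assert (0 <= c * Cmod (approx_inv c y)) by (apply Rmult_le_pos; lra). nra.
Qed.

(** The error splits into [Psi z + c z ln z], small by the hypothesis on [Psi], and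
    [c z (ln z - ln y)], small by [Cln_close]. *)
Lemma Psi_near_approx_inv (eps : R) : 0 < eps -> exists rho, 0 < rho /\
  forall y z : C, 0 < Cmod y < rho -> sector s PI z ->
  Cmod (z - approx_inv c y) <= Cmod (approx_inv c y) / 2 ->
  Cmod (Psi z - y / approx_inv c y * z) <= eps * Cmod y.
Proof.
intros He. set (d := Rmin 1 (eps / 5)).
assert (Hd : 0 < d) by (apply Rmin_pos; lra).
assert (Hd1 : d <= 1) by apply Rmin_l.
assert (Hd2 : d <= eps / 5) by apply Rmin_r.
destruct (proj1 (equiv_at_0_iff _ _ _) HPsi d Hd) as [r1 [Hr1 H1]].
destruct (Cln_close (1 + Rabs (ln c)) d Hd) as [r2 [Hr2 H2]].
destruct (approx_inv_small (r1 / 2) ltac:(lra)) as [r3 [Hr3 H3]].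
exists (Rmin r2 r3). split; [now apply Rmin_pos|]. intros y z [Hy Hy'] Hz Hzy.
assert (Y2 : Cmod y < r2) by (eapply Rlt_le_trans; [exact Hy'|apply Rmin_l]).
assert (Y3 : Cmod y < r3) by (eapply Rlt_le_trans; [exact Hy'|apply Rmin_r]).
destruct (H3 y (conj Hy Y3)) as [HL [Ha Ha']].
pose proof (Cmod_approx_inv y ltac:(lra)) as E.
set (a := approx_inv c y) in *.
set (L := Cmod (Cln y)) in *.
pose proof (Cmod_reverse_triangle z a) as T1.
pose proof (Cmod_reverse_triangle a z) as T2. rewrite Cmod_sub_sym in T2.
assert (Hza : Cmod a / 2 <= Cmod z <= 2 * Cmod a) by lra.
specialize (H1 z Hz ltac:(lra)). specialize (H2 y z (conj Hy Y2)).
assert (Hln : Rabs (ln (Cmod z) - ln (Cmod y))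
   <= 1 + Rabs (ln c) + Rabs (ln L)).
{ rewrite E, ln_mult, ln_mult by (try apply Rmult_lt_0_compat; lra).
  pose proof (ln_dist_le_1 (Cmod a) (Cmod z) Ha Hza) as B.
  replace (ln (Cmod z) - (ln c + ln (Cmod a) + ln L))
    with ((ln (Cmod z) - ln (Cmod a)) + - (ln c + ln L)) by ring.
  eapply Rle_trans; [apply Rabs_triang|]. rewrite Rabs_Ropp.
  pose proof (Rabs_triang (ln c) (ln L)). lra. }
specialize (H2 Hln). fold L in H2.
assert (Hy0 : y <> 0%C) by now apply Cmod_neq_0.
unfold a. rewrite approx_inv_slope by (auto; fold L; lra).
replace (Psi z - - (RtoC c * Cln y) * z)%C
  with (- (- (RtoC c * z * Cln z) - Psi z) + - (RtoC c * z * (Cln z - Cln y)))%C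
  by ring.
eapply Rle_trans; [apply Cmod_triangle|].
rewrite !Cmod_opp, !Cmod_mult, Cmod_R, Rabs_pos_eq in * by lra.
set (w := c * Cmod z) in *.
assert (Hw : 0 <= w <= 3 / 2 * (c * Cmod a)).
{ unfold w. split; [apply Rmult_le_pos; lra|].
  replace (3 / 2 * (c * Cmod a)) with (c * (3 / 2 * Cmod a)) by ring.
  apply Rmult_le_compat_l; lra. }
assert (HLz : Cmod (Cln z) <= 2 * L).
{ pose proof (Cmod_reverse_triangle (Cln z) (Cln y)) as B. fold L in B. nra. }
assert (HwL : w * L <= 3 / 2 * Cmod y).
{ rewrite E. replace (3 / 2 * (c * Cmod a * L)) with (3 / 2 * (c * Cmod a) * L) by ring.
  apply Rmult_le_compat_r; lra. }
assert (A1 : w * Cmod (Cln z) <= 2 * (w * L)).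
{ replace (2 * (w * L)) with (w * (2 * L)) by ring.
  apply Rmult_le_compat_l; lra. }
assert (A2 : w * Cmod (Cln z - Cln y) <= d * (w * L)).
{ replace (d * (w * L)) with (w * (d * L)) by ring.
  apply Rmult_le_compat_l; lra. }
assert (0 <= w * Cmod (Cln z)) by (apply Rmult_le_pos; [lra|apply Cmod_ge_0]).
nra.
Qed.

(** With [y = Psi z], [z - approx_inv c y] is [(y + c z ln y) / (c ln y)], and the numerator splits
    into [y + c z ln z] and [c z (ln y - ln z)]. *)
Lemma Psi_preimage_near (eps : R) : 0 < eps -> exists rho, 0 < rho /\
  forall z : C, sector rho PI z -> sector s PI z ->
  Cmod (z - approx_inv c (Psi z)) <= eps * Cmod (approx_inv c (Psi z)).
Proof.
intros He. set (d := Rmin (1 / 2) (eps / 4)).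
assert (Hd : 0 < d) by (apply Rmin_pos; lra).
assert (Hd1 : d <= 1 / 2) by apply Rmin_l.
assert (Hd2 : d <= eps / 4) by apply Rmin_r.
destruct (proj1 (equiv_at_0_iff _ _ _) HPsi d Hd) as [r1 [Hr1 H1]].
destruct (Cln_close (1 + Rabs (ln c)) d Hd) as [r2 [Hr2 H2]].
destruct (ln_small 1) as [r3 [Hr3 H3]].
exists (Rmin r1 (Rmin r2 r3)). split; [repeat apply Rmin_pos; lra|].
intros z Hz Hzs. apply sector_PI_iff in Hz. destruct Hz as [[Hz Hz'] _].
pose proof (Rmin_l r1 (Rmin r2 r3)). pose proof (Rmin_r r1 (Rmin r2 r3)).
pose proof (Rmin_l r2 r3). pose proof (Rmin_r r2 r3).
specialize (H1 z Hzs ltac:(lra)).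
specialize (H3 (Cmod z) ltac:(lra)). pose proof (Cmod_Cln_ge z) as HLz.
set (y := Psi z) in *. set (L := Cmod (Cln z)) in *.
assert (HL : 1 <= L) by lra.
pose proof (Cmod_reverse_triangle y (- (RtoC c * z * Cln z))) as T1.
pose proof (Cmod_reverse_triangle (- (RtoC c * z * Cln z)) y) as T2.
rewrite Cmod_sub_sym in T1.
assert (Eg : Cmod (- (RtoC c * z * Cln z)) = c * Cmod z * L).
{ rewrite Cmod_opp, !Cmod_mult, Cmod_R, Rabs_pos_eq by lra. reflexivity. }
rewrite Eg in *. set (g := c * Cmod z * L) in *.
assert (Hg : 0 < g) by (unfold g; repeat apply Rmult_lt_0_compat; lra).
assert (Hyg : g / 2 <= Cmod y <= 2 * g) by nra.
assert (Hy : 0 < Cmod y) by lra.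
assert (Hln : Rabs (ln (Cmod y) - ln (Cmod z)) <= 1 + Rabs (ln c) + Rabs (ln L)).
{ pose proof (ln_dist_le_1 g (Cmod y) Hg Hyg) as B.
  unfold g in B. rewrite ln_mult, ln_mult in B
    by (try apply Rmult_lt_0_compat; lra).
  replace (ln (Cmod y) - ln (Cmod z))
    with ((ln (Cmod y) - (ln c + ln (Cmod z) + ln L)) + (ln c + ln L)) by ring.
  eapply Rle_trans; [apply Rabs_triang|].
  pose proof (Rabs_triang (ln c) (ln L)). lra. }
specialize (H2 z y ltac:(lra) Hln). fold L in H2.
assert (HLy : 0 < Cmod (Cln y)).
{ pose proof (Cmod_reverse_triangle (Cln z) (Cln y)) as B.
  rewrite Cmod_sub_sym in B. fold L in B. nra. }
pose proof (Cmod_approx_inv y HLy) as E.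
assert (NL : Cln y <> 0%C) by now apply Cmod_neq_0.
assert (Nc : RtoC c <> 0%C) by (apply RtoC_neq_0; lra).
replace (z - approx_inv c y)%C
  with ((- (- (RtoC c * z * Cln z) - y) + RtoC c * z * (Cln y - Cln z))
        / (RtoC c * Cln y))%C
  by (unfold approx_inv; field; auto).
rewrite Cmod_div by now apply Cmult_neq_0.
rewrite (Cmod_mult (RtoC c) (Cln y)), Cmod_R, Rabs_pos_eq by lra.
assert (HcL : 0 < c * Cmod (Cln y)) by (apply Rmult_lt_0_compat; lra).
apply (Rmult_le_reg_r (c * Cmod (Cln y))); [exact HcL|].
unfold Rdiv. rewrite Rmult_assoc, Rinv_l, Rmult_1_r by lra.
replace (eps * Cmod (approx_inv c y) * (c * Cmod (Cln y)))
  with (eps * Cmod y) by (rewrite E at 1; ring).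
eapply Rle_trans; [apply Cmod_triangle|].
rewrite Cmod_opp, !Cmod_mult, Cmod_R, (Rabs_pos_eq c) by lra.
assert (A : c * Cmod z * Cmod (Cln y - Cln z) <= d * g).
{ unfold g. replace (d * (c * Cmod z * L)) with (c * Cmod z * (d * L)) by ring.
  apply Rmult_le_compat_l; [apply Rmult_le_pos; lra|exact H2]. }
nra.
Qed.

End Asymptotics.

(** [approx_inv c y] is close to a positive multiple [p y] of [y], and in the sector [Re y + |y|]
    exceeds [(1 + cos alpha) |y|]. *)
Lemma approx_inv_disc_in_slit_plane (c alpha : R) : 0 < c -> 0 < alpha < PI ->
  exists eta rho, 0 < eta <= 1 / 2 /\ 0 < rho /\
  forall y z : C, sector rho alpha y ->
  Cmod (z - approx_inv c y) <= eta * Cmod (approx_inv c y) ->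
  0 < Re z + Cmod z.
Proof.
intros Hc Ha. pose proof PI_RGT_0 as HPI.
assert (Hcos : -1 < cos alpha).
{ rewrite <- cos_PI. apply cos_decreasing_1; lra. }
pose proof (COS_bound alpha) as Hcos1.
(* A point of the disc is within [2 eta p |y|] of [p y]; this affects [Re] and [Cmod] alike, hence
   the 4. *)
set (eta := (1 + cos alpha) / 4).
assert (Heta : 0 < eta <= 1 / 2) by (unfold eta; lra).
destruct (ln_small (1 + PI / eta)) as [rho [Hrho Hln]].
assert (HPe : 0 < PI / eta) by (apply Rdiv_lt_0_compat; lra).
exists eta, rho. split; [exact Heta|]. split; [exact Hrho|].
intros y z Hy Hz. apply sector_iff in Hy; [|lra].
destruct Hy as [Hy Hre]. specialize (Hln _ Hy).
pose proof (Cmod_Cln_ge y) as HLy.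
set (L := - ln (Cmod y)) in *.
pose proof (Cmod_approx_inv c Hc y ltac:(lra)) as E.
assert (HL : 0 < L) by lra.
assert (NL : Cln y <> 0%C) by (apply Cmod_neq_0; lra).
assert (Nc : RtoC c <> 0%C) by (apply RtoC_neq_0; lra).
set (p := / (c * L)).
assert (HcL : 0 < c * L) by (apply Rmult_lt_0_compat; lra).
assert (Hp : 0 < p) by (apply Rinv_0_lt_compat; lra).
set (a := approx_inv c y) in *.
assert (Hap : Cmod a <= p * Cmod y).
{ rewrite E. apply (Rmult_le_reg_l (c * L)); [exact HcL|].
  unfold p. rewrite <- Rmult_assoc, Rinv_r, Rmult_1_l by lra.
  replace (c * L * Cmod a) with (c * Cmod a * L) by ring.
  apply Rmult_le_compat_l; [|lra]. apply Rmult_le_pos; [lra|apply Cmod_ge_0]. }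
(* [p] comes from dropping the argument of [y] in [Cln y], so that
   [a - p y] is [a] times the relative error of that approximation *)
assert (Hd : Cmod (a - RtoC p * y) <= eta * Cmod a).
{ replace (a - RtoC p * y)%C with (a * (1 + RtoC (p * c) * Cln y))%C
    by (unfold a, approx_inv; rewrite RtoC_mult; field; auto).
  rewrite Cmod_mult, Rmult_comm.
  apply Rmult_le_compat_r; [apply Cmod_ge_0|].
  replace (1 + RtoC (p * c) * Cln y)%C with ((0, Im (Cln y) / L) : C).
  2:{ assert (E1 : p * c * ln (Cmod y) = -1)
        by (replace (ln (Cmod y)) with (- L) by (unfold L; ring);
            unfold p; field; lra).
      assert (E2 : p * c * Im (Cln y) = Im (Cln y) / L)
        by (unfold p; field; lra).
      replace (Cln y) with ((ln (Cmod y), Im (Cln y)) : C) at 2 by reflexivity.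
      unfold Cplus, Cmult, RtoC; cbn [fst snd]. f_equal; lra. }
  eapply Rle_trans; [apply Cmod_le_re_im|]. cbn [Re Im fst snd].
  rewrite Rabs_R0, Rplus_0_l. unfold Rdiv. rewrite Rabs_mult.
  rewrite (Rabs_pos_eq (/ L)) by (left; apply Rinv_0_lt_compat; lra).
  apply (Rmult_le_reg_r L); [exact HL|].
  rewrite Rmult_assoc, Rinv_l, Rmult_1_r by lra.
  eapply Rle_trans; [apply Cln_Im_bound|].
  apply Rle_trans with (eta * (PI / eta)); [right; field; lra|].
  apply Rmult_le_compat_l; lra. }
assert (Hzp : Cmod (z - RtoC p * y) <= 2 * eta * (p * Cmod y)).
{ pose proof (Cmod_sub_triangle a z (RtoC p * y)). nra. }
pose proof (re_le_Cmod (z - RtoC p * y)) as R1. apply Rabs_le_between in R1.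
replace (Re (z - RtoC p * y)) with (Re z - p * Re y) in R1
  by (destruct z, y; simpl; ring).
pose proof (Cmod_reverse_triangle (RtoC p * y) z) as R2.
rewrite Cmod_sub_sym, Cmod_mult, Cmod_R, Rabs_pos_eq in R2 by lra.
assert (0 < p * (Re y + Cmod y - 4 * eta * Cmod y)).
{ apply Rmult_lt_0_compat; [exact Hp|]. unfold eta. lra. }
lra.
Qed.

(** * The inverse function *)

Theorem theorem7p1 :
  forall (Psi : C -> C) (s c : R),
    0 < s -> 0 < c ->
    analytic_on (sector s PI) Psi ->
    equiv_at_0 (sector s PI) Psi (fun z : C => (- (RtoC c * z * Cln z))%C) ->
    forall alpha : R, 0 < alpha < PI ->
    exists (rho rho' : R) (Upsilon : C -> C),
      0 < rho < s /\
      0 < rho' /\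
      analytic_on (sector rho' alpha) Upsilon /\
      (forall y : C, sector rho' alpha y -> sector rho PI (Upsilon y)) /\
      (forall y z : C, sector rho' alpha y -> sector rho PI z ->
         (Psi z = y <-> z = Upsilon y)) /\
      equiv_at_0 (sector rho' alpha) Upsilon
        (fun y : C => (- (y / (RtoC c * Cln y)))%C).
Proof.
intros Psi s c Hs Hc Han HPsi alpha Ha. pose proof PI_RGT_0 as HPI.
assert (Hstrict : forall z, sector s PI z -> exists d, strict_at Psi z d).
{ intros z Hz. destruct (Han z Hz) as [a Hpa]. exists (a 1%nat).
  now apply pseries_strict_at. }
destruct (approx_inv_disc_in_slit_plane c alpha Hc Ha)
  as [eta [r1 [Heta [Hr1 Hdisc]]]].
(* With radius [eta |a|] and slope [m], [|m| |a| = |y|], so an error [eta / 32 * |y|] meets the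
   condition [32 e <= |m| r] with equality. *)
destruct (Psi_near_approx_inv Psi s c Hc HPsi (eta / 32) ltac:(lra))
  as [r2 [Hr2 Hnear]].
(* Half of the radius [eta / 4] on which [Psi] expands, so that every solution has a full
   neighbourhood inside that disc. *)
destruct (Psi_preimage_near Psi s c Hc HPsi (eta / 8) ltac:(lra))
  as [r3 [Hr3 Hpre]].
set (rho := Rmin r3 (s / 2)).
assert (Hrho : 0 < rho) by (apply Rmin_pos; lra).
assert (Hrho3 : rho <= r3) by apply Rmin_l.
assert (Hrhos : rho <= s / 2) by apply Rmin_r.
destruct (approx_inv_small c Hc (rho / 2) ltac:(lra)) as [r4 [Hr4 Hsmall]].
set (rho' := Rmin r1 (Rmin r2 r4)).
assert (Hrho' : 0 < rho') by (repeat apply Rmin_pos; lra).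
assert (Hle : rho' <= r1 /\ rho' <= r2 /\ rho' <= r4).
{ pose proof (Rmin_l r1 (Rmin r2 r4)). pose proof (Rmin_r r1 (Rmin r2 r4)).
  pose proof (Rmin_l r2 r4). pose proof (Rmin_r r2 r4). unfold rho'. lra. }
assert (Hsub : forall t t' z, t <= t' -> sector t PI z -> sector t' PI z).
{ intros t t' z Ht Hz. apply sector_PI_iff in Hz. apply sector_PI_iff.
  split; [split|]; lra. }
assert (Hyb : forall y, sector rho' alpha y ->
  0 < Cmod y < rho' /\ sector r1 alpha y).
{ intros y Hy. apply sector_iff in Hy; [|lra]. split; [tauto|].
  apply sector_iff; [lra|]. split; [split|]; lra. }
assert (Hball : forall y z, sector rho' alpha y ->
  Cmod (z - approx_inv c y) <= eta * Cmod (approx_inv c y) -> sector rho PI z).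
{ intros y z Hy Hz. destruct (Hyb y Hy) as [Hy1 Hy2].
  destruct (Hsmall y ltac:(lra)) as [_ [A1 A2]].
  pose proof (Cmod_reverse_triangle z (approx_inv c y)) as B1.
  pose proof (Cmod_reverse_triangle (approx_inv c y) z) as B2.
  rewrite Cmod_sub_sym in B2.
  apply sector_PI_iff. split; [nra|]. now apply (Hdisc y). }
set (m := fun y => (y / approx_inv c y)%C).
assert (Hm : forall y, sector rho' alpha y ->
  m y <> 0%C /\ (m y * approx_inv c y = y)%C
  /\ Cmod (m y) * Cmod (approx_inv c y) = Cmod y
  /\ 0 < Cmod (approx_inv c y)).
{ intros y Hy. destruct (Hyb y Hy) as [Hy1 _].
  destruct (Hsmall y ltac:(lra)) as [_ [A1 _]].
  assert (Nz : approx_inv c y <> 0%C) by now apply Cmod_neq_0.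
  assert (E : (m y * approx_inv c y = y)%C) by (unfold m; field; exact Nz).
  repeat split; auto.
  - intros E0. rewrite E0, Cmult_0_l in E. rewrite <- E, Cmod_0 in Hy1. lra.
  - rewrite <- Cmod_mult. now rewrite E. }
assert (Hlin : forall y, sector rho' alpha y ->
  let a := approx_inv c y in let r := eta * Cmod a in let e := eta / 32 * Cmod y in
  0 < r /\
  (forall z, Cmod (z - a) < r -> exists d, strict_at Psi z d) /\
  (forall z, Cmod (z - a) < r -> Cmod (Psi z - m y * z) <= e) /\
  32 * e <= Cmod (m y) * r).
{ intros y Hy a r e. destruct (Hyb y Hy) as [Hy1 _].
  destruct (Hm y Hy) as [_ [_ [E A]]]. fold a in A, E.
  assert (HsD : forall z, Cmod (z - a) < r -> sector s PI z).
  { intros z Hz. apply (Hsub rho); [lra|]. apply (Hball y); [exact Hy|].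
    unfold r, a in Hz. lra. }
  split; [apply Rmult_lt_0_compat; lra|]. split; [|split].
  - intros z Hz. apply Hstrict. now apply HsD.
  - intros z Hz. apply Hnear; [lra|now apply HsD|].
    fold a. unfold r in Hz. nra.
  - unfold e, r. rewrite <- E. right. field. }
assert (Hexp : forall y, sector rho' alpha y -> forall z w,
  Cmod (z - approx_inv c y) <= eta * Cmod (approx_inv c y) / 4 ->
  Cmod (w - approx_inv c y) <= eta * Cmod (approx_inv c y) / 4 ->
  Cmod (m y) / 2 * Cmod (z - w) <= Cmod (Psi z - Psi w)).
{ intros y Hy. destruct (Hlin y Hy) as [L1 [L2 [L3 L4]]].
  exact (near_linear_expanding Psi _ _ _ _ L1 L2 L3 L4). }
(* Targets [y'] near [y] are solved in the disc attached to [y] itself; the case [y' = y] gives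
   existence, the general case continuity. *)
assert (Honto : forall y y', sector rho' alpha y ->
  Cmod (y' - y) <= eta / 16 * Cmod y ->
  exists z : C, Cmod (z - approx_inv c y) <= eta * Cmod (approx_inv c y) / 4
    /\ Psi z = y').
{ intros y y' Hy Hyy'. destruct (Hlin y Hy) as [L1 [L2 [L3 L4]]].
  destruct (Hm y Hy) as [M1 [M2 [M3 _]]].
  apply (near_linear_onto Psi _ (m y) _ _ L1 M1 L2 L3 L4).
  rewrite M2. rewrite <- M3 in Hyy'. lra. }
assert (Hpre' : forall y z, Psi z = y -> sector rho PI z ->
  Cmod (z - approx_inv c y) <= eta / 8 * Cmod (approx_inv c y)).
{ intros y z Hzy Hz. subst y. apply Hpre; eapply Hsub; try exact Hz; lra. }
assert (Huniq : forall y z w, sector rho' alpha y ->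
  sector rho PI z -> sector rho PI w -> Psi z = y -> Psi w = y -> z = w).
{ intros y z w Hy Hz Hw Ez Ew. destruct (Hm y Hy) as [M1 [_ [_ A]]].
  apply Cmod_gt_0 in M1.
  pose proof (Hpre' y z Ez Hz) as Pz. pose proof (Hpre' y w Ew Hw) as Pw.
  pose proof (Hexp y Hy z w ltac:(nra) ltac:(nra)) as H.
  rewrite Ez, Ew in H. replace (y - y)%C with (RtoC 0) in H by ring.
  rewrite Cmod_0 in H. pose proof (Cmod_ge_0 (z - w)) as H0.
  assert (E : Cmod (z - w) = 0) by nra.
  apply Cmod_eq_0 in E. replace z with ((z - w) + w)%C by ring. rewrite E. ring. }
set (Ups := fun y => epsilon (inhabits (RtoC 0))
  (fun z => sector rho PI z /\ Psi z = y)).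
assert (HUps : forall y, sector rho' alpha y ->
  sector rho PI (Ups y) /\ Psi (Ups y) = y).
{ intros y Hy. apply epsilon_spec.
  destruct (Hyb y Hy) as [Hy1 _].
  destruct (Honto y y Hy) as [z [Hz Ez]].
  - replace (y - y)%C with (RtoC 0) by ring. rewrite Cmod_0. nra.
  - exists z. split; [|exact Ez]. apply (Hball y); [exact Hy|].
    destruct (Hm y Hy) as [_ [_ [_ A]]]. nra. }
assert (Hopen : forall y, sector rho' alpha y -> locally y (sector rho' alpha))
  by (intros y Hy; apply sector_open; [lra|exact Hy]).
exists rho, rho', Ups. repeat split; try lra.
- apply analytic_on_strict; [exact Hopen|].
  intros y Hy. destruct (HUps y Hy) as [U1 U2].
  destruct (Hyb y Hy) as [Hy1 _].
  destruct (Hm y Hy) as [M1 [_ [_ A]]]. apply Cmod_gt_0 in M1.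
  pose proof (Hpre' y _ U2 U1) as P.
  destruct (Hstrict (Ups y)) as [d Hd]; [apply (Hsub rho); [lra|exact U1]|].
  exists (/ d)%C. apply (strict_at_inverse Psi Ups y d (Cmod (m y) / 2)).
  + lra.
  + apply (strict_at_derivative_neq_0 Psi (Ups y) d (Cmod (m y) / 2)
      (eta * Cmod (approx_inv c y) / 8)); [lra|nra|exact Hd|].
    intros z Hz. apply (Hexp y Hy); [|nra].
    pose proof (Cmod_sub_triangle (Ups y) z (approx_inv c y)). nra.
  + exact Hd.
  + generalize (Hopen y Hy). apply filter_imp. intros v Hv. now apply HUps.
  + destruct (proj1 (locally_Cmod _ _) (Hopen y Hy)) as [r5 [Hr5 H5]].
    exists (Rmin r5 (eta / 16 * Cmod y)).
    split; [apply Rmin_pos; nra|].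
    (* [Honto] solves [Psi z = v] in the disc centred at [approx_inv c y], and uniqueness identifies
       this solution with [Ups v]. All nearby values thus lie in one disc, where [Hexp] applies. *)
    assert (Hloc : forall v, Cmod (v - y) < Rmin r5 (eta / 16 * Cmod y) ->
      Psi (Ups v) = v /\
      Cmod (Ups v - approx_inv c y) <= eta * Cmod (approx_inv c y) / 4).
    { intros v Hv. pose proof (Rmin_l r5 (eta / 16 * Cmod y)).
      pose proof (Rmin_r r5 (eta / 16 * Cmod y)).
      assert (Hvs : sector rho' alpha v) by (apply H5; lra).
      destruct (HUps v Hvs) as [V1 V2]. split; [exact V2|].
      destruct (Honto y v Hy ltac:(lra)) as [z [Hz Ez]].
      rewrite (Huniq v (Ups v) z); auto.
      apply (Hball y); [exact Hy|]. nra. }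
    intros v w Hv Hw. destruct (Hloc v Hv) as [V1 V2].
    destruct (Hloc w Hw) as [W1 W2].
    pose proof (Hexp y Hy _ _ V2 W2) as H. rewrite V1, W1 in H. exact H.
- intros y Hy. now apply HUps.
- intros Hzy. destruct (HUps y) as [U1 U2]; [assumption|].
  now apply (Huniq y).
- intros ->. now apply HUps.
- apply equiv_at_0_iff. intros eps Heps.
  destruct (Psi_preimage_near Psi s c Hc HPsi eps Heps) as [r5 [Hr5 H5]].
  (* By [Hpre'], [|Ups y|] is less than twice [|approx_inv c y|], so [r5 / 2] brings [Ups y] within
     the range of [H5]. *)
  destruct (approx_inv_small c Hc (r5 / 2) ltac:(lra)) as [r6 [Hr6 H6]].
  exists r6. split; [exact Hr6|]. intros y Hy Hy6.
  change (Cmod (approx_inv c y - Ups y) <= eps * Cmod (approx_inv c y)).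
  destruct (HUps y Hy) as [U1 U2]. destruct (Hyb y Hy) as [Hy1 _].
  destruct (H6 y ltac:(lra)) as [_ A].
  pose proof (Hpre' y _ U2 U1) as P.
  pose proof (Cmod_reverse_triangle (Ups y) (approx_inv c y)) as B.
  (* The arguments of [approx_inv] are rewritten as [Psi (Ups y)], which makes the goal an instance
     of [H5] at [Ups y]. *)
  rewrite Cmod_sub_sym. rewrite <- U2 at 2 3. apply H5.
  + apply sector_PI_iff in U1. apply sector_PI_iff. split; [|tauto].
    split; [tauto|]. nra.
  + apply (Hsub rho); [lra|exact U1].
Qed.
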